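(* Let $d=d(n)$ and $n$ be positive integers with $d=\omega(1)$ and $d\le\sqrt{n}$, and let $\epsilon>0$ be a small constant. Then there exists a $d$-regular graph $G$ on $n$ vertices such that: for every $U\subseteq V(G)$ with $|U|\le n/2$, $e(U,U^C)\ge |U|/10$; and for every $U\subseteq V(G)$ with $|U|\le \epsilon d/3$, $e(U,U^C)\ge(1-\epsilon)d|U|$; and, in the random graph process on $G$, letting $\tau_1$ be the hitting time of minimum degree at least one and $\tau_{conn}$ the hitting time of connectivity, with high probability $\tau_1<\tau_{conn}$.
   Context: All asymptotics are as $n\to\infty$; ''with high probability'' means with probability tending to $1$ as $n\to\infty$. Suitable divisibility/parity assumptions on $n$ and $d$ (so that the required regular graph can exist) are implicitly assumed. For $U\subseteq V(G)$, $U^C=V(G)\setminus U$ and $e(U,U^C)$ is the number of edges of $G$ with exactly one endpoint in $U$. The random graph process on $G=(V,E)$: $G(0)$ is the empty graph on $V$, and for $1\le i\le|E|$, $G(i)$ is obtained from $G(i-1)$ by adding an edge chosen uniformly at random from $E\setminus E(G(i-1))$. The hitting time of a monotone increasing property $\mathcal{P}$ is the minimum index $\tau$ with $G(\tau)\in\mathcal{P}$. *)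

(* Defs.v *)
From HB Require Import structures.
From mathcomp Require Import all_boot all_order all_algebra.
From mathcomp Require Import all_classical all_reals all_analysis.

Set Implicit Arguments.
Unset Strict Implicit.
Unset Printing Implicit Defensive.

Import Order.TTheory GRing.Theory Num.Theory.
Import numFieldNormedType.Exports.

Local Open Scope ring_scope.

(* A graph on the vertex set V is given by its set of edges, an edge being a
   2-element set of vertices. *)
Section Graphs.
Variable V : finType.
Implicit Types (E : {set {set V}}) (U : {set V}).

Definition simple_graph E : bool := [forall e in E, #|e| == 2%N].

Definition degree E (v : V) : nat := #|[set e in E | v \in e]|.

Definition regular_graph (k : nat) E : bool :=
  simple_graph E && [forall v, degree E v == k].

(* e(U, U^C) *)
Definition edge_boundary E U : nat := #|[set e in E | #|e :&: U| == 1%N]|.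

Definition adjacent E : rel V := fun x y => (x != y) && ([set x; y] \in E).

Definition connected_graph E : bool := [forall x, forall y, connect (adjacent E) x y].

Definition min_degree_ge1 E : bool := [forall v, (1 <= degree E v)%N].

End Graphs.

(* A run of the process on E is recorded as the sequence s of the added edges;
   its i-th graph is the set of the first i of them. *)
Section RandomGraphProcess.
Variables (R : realType) (V : finType) (E : {set {set V}}).
Implicit Types (s : #|E|.-tuple {set V}).

Definition process_graph s (i : nat) : {set {set V}} :=
  [set e in take i (val s)].

(* Chain rule: conditionally on the graph after i steps, the next edge is
   uniform on the edges of E not yet present. *)
Definition process_weight s : R :=
  \prod_(i < #|E|)
    (if tnth s i \in E :\: process_graph s i
     then (#|E :\: process_graph s i|%:R)^-1 else 0).

Definition process_prob (A : pred (#|E|.-tuple {set V})) : R :=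
  \sum_(s | A s) process_weight s.

(* Least i <= #|E| such that the i-th graph satisfies P; if there is none, the
   value is #|E|.+1, which plays the role of infinity. *)
Definition hitting_time (P : pred {set {set V}}) s : nat :=
  find (fun i => P (process_graph s i)) (iota 0 #|E|.+1).

Definition tau_1 : #|E|.-tuple {set V} -> nat :=
  hitting_time (@min_degree_ge1 V).

Definition tau_conn : #|E|.-tuple {set V} -> nat :=
  hitting_time (@connected_graph V).

End RandomGraphProcess.

(* Main.v *)
Require Import Defs.
From HB Require Import structures.
From mathcomp Require Import all_boot all_order all_algebra.
From mathcomp Require Import fingroup perm zify ring lra reals.

Set Implicit Arguments.
Unset Strict Implicit.
Unset Printing Implicit Defensive.

Import Order.TTheory GRing.Theory Num.Theory.

(** The graph consists of about n / (2 (d + 1)) clumps and a core of at least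
    n / 2 vertices. A clump is a complete graph on d + 1 vertices from which a
    matching of q = d / 7 edges is removed; each of the 2q vertices of the
    matching is joined to a core vertex of its own. The core carries a union of
    24 permutations with vertex expansion 1/2, which exists by a union bound, and
    is completed to a d-regular graph by edge switching.

    A set containing whole clumps pays for them with their 2q ports, unless it
    also contains the attached core vertices, which pay through the expansion of
    the core. A set of u vertices spans at most u^2 / 2 edges, so the expansion of
    sets of size at most eps d / 3 holds in every d-regular graph.

    In the process, look at the moment when a fraction n^(-3/(2d)) of the edges
    is still missing. A given vertex is isolated with probability at most
    n^(-3/2), so there are no isolated vertices. A given clump is cut off with
    probability of order n^(-3 * 2q / (2d)) >= n^(-3/7), while there are of order
    n^(1/2) clumps at least, and their boundaries are disjoint, so the second
    moment method yields a clump that is cut off. *)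

(** * Permutations mapping one set into another *)

Definition perms_into (V : finType) (C S T : {set V}) : {set {perm V}} :=
  [set p : {perm V} | perm_on C p && (p @: S \subset T)].

(** Double counting of pairs [(p, y)] with [p] in [perms_into C S T], [y] in [C :\: S] and [p y] in
    [T]. A transposition fixing [S] pointwise shows that each [y] occurs equally often; each [p]
    admits [|T| - |S|] values of [y], the preimages of [T] outside [S]. *)
Lemma perms_into_step (V : finType) (C S T : {set V}) (x : V) :
  S \subset C -> T \subset C -> x \in C -> x \notin S ->
  (#|perms_into C (x |: S) T| * (#|C| - #|S|) =
   #|perms_into C S T| * (#|T| - #|S|)).
Proof.
move=> SC TC xC xS.
have swap y : y \in C :\: S ->
    #|perms_into C (y |: S) T| = #|perms_into C (x |: S) T|.
  move=> /setDP[yC yS].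
  have fixS z : z \in S -> tperm x y z = z.
    by move=> zS; apply: tpermD; [apply: contraNneq xS => ->|apply: contraNneq yS => ->].
  have txC : perm_on C (tperm x y).
    apply/subsetP => z; rewrite inE.
    by case: tpermP => [-> | -> | _ _]; rewrite ?eqxx.
  have sub u v : (u \in [:: x; y]) -> v = tperm x y u ->
      forall p : {perm V}, p \in perms_into C (v |: S) T ->
      (tperm x y * p)%g \in perms_into C (u |: S) T.
    move=> uxy -> p; rewrite !inE => /andP[pC pS]; rewrite perm_onM//=.
    apply/subsetP => _ /imsetP[z zS ->]; rewrite permM.
    apply: (subsetP pS); apply/imset_f.
    case/setU1P: zS => [->|zS]; first exact: setU11.
    by rewrite fixS// setU1r.
  apply/eqP; rewrite eqn_leq; apply/andP; split.
    rewrite -(card_imset _ (@mulgI _ (tperm x y))).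
    apply/subset_leq_card/subsetP => _ /imsetP[p pi ->].
    by apply: (sub x y) => //; rewrite ?inE ?eqxx // tpermL.
  rewrite -(card_imset _ (@mulgI _ (tperm x y))).
  apply/subset_leq_card/subsetP => _ /imsetP[p pi ->].
  by apply: (sub y x) => //; rewrite ?inE ?eqxx ?orbT // tpermR.
have -> : (#|C| - #|S|) = #|C :\: S|.
  by rewrite cardsD (setIidPr SC).
rewrite mulnC -sum_nat_const.
rewrite (eq_bigr (fun y => #|perms_into C (y |: S) T|)); last first.
  by move=> y yCS; rewrite swap.
under eq_bigr do rewrite -sum1_card.
have -> : (\sum_(y in C :\: S)
   \sum_(p in perms_into C (y |: S) T) 1 =
   \sum_(y in C :\: S)
     \sum_(p in perms_into C S T | p y \in T) 1).
  apply: eq_bigr => y _; apply: eq_bigl => p.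
  rewrite !inE imsetU1 -andbA; congr (_ && _).
  by rewrite subUset sub1set andbC.
rewrite (exchange_big_dep (mem (perms_into C S T)))//=.
rewrite -sum_nat_const; apply: eq_bigr => p.
rewrite inE => /andP[pC pS].
rewrite sum1_card.
  have <- : #|p @^-1: T :\: S| = (#|T| - #|S|).
  rewrite cardsD card_preimset; last exact: perm_inj.
  congr (_ - #|pred_of_set _|); apply/setIidPr/subsetP => z zS.
  by rewrite inE (subsetP pS)// imset_f.
  apply: eq_card => y; rewrite !inE unfold_in /= !inE pC pS /=.
  case yT: (p y \in T); rewrite ?andbF ?andbT//.
  by rewrite -(perm_closed y pC) (subsetP TC) ?andbT.
by move=> y p _ /andP[].
Qed.

(** Adding the points of [S] one at a time multiplies the probability that a uniform permutation of
    [C] maps [S] into [T] by [(|T| - i) / (|C| - i)]. The count serves both the union bound for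
    expanders and the analysis of the process. *)
Lemma card_perms_into (V : finType) (C S T : {set V}) :
  S \subset C -> T \subset C ->
  (#|perms_into C S T| * #|C| ^_ #|S| = #|T| ^_ #|S| * #|C|`!).
Proof.
move Es: #|S| => s; elim: s S Es => [|s IHs] S Es SC TC.
  rewrite !ffactn0 muln1 mul1n -card_perm.
  apply: eq_card => p; rewrite !inE (cards0_eq Es) imset0 sub0set andbT.
  by [].
have /card_gt0P[x xS] : (0 < #|S|) by rewrite Es.
have Es' : #|S :\ x| = s by move: (cardsD1 x S); rewrite xS Es => -[].
have SC' : S :\ x \subset C by apply: subset_trans SC; apply: subsetDl.
have := perms_into_step SC' TC (subsetP SC x xS) (negbT (setD11 x S)).
rewrite setD1K// Es' => H.
rewrite !ffactnSr [(#|C| ^_ s * _)]mulnC mulnA H mulnAC IHs//.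
by rewrite mulnAC.
Qed.

Lemma ffact_ratio_le (t n s : nat) : t <= n -> t ^_ s * n ^ s <= t ^ s * n ^_ s.
Proof.
move=> tn; elim: s => [|s IHs]; first by rewrite !ffactn0 !expn0.
rewrite !ffactnSr !expnSr.
have step : (t - s) * n <= t * (n - s).
  have [ts|/ltnW st] := leqP t s; first by rewrite (eqP ts).
  by rewrite mulnBl mulnBr leq_sub2l// mulnC leq_mul2l tn orbT.
have := leq_mul IHs step; nia.
Qed.

(* The factor 4^t comes from t^t <= (2t)!/t! = 'C(2t, t) * t!. *)
Lemma bin_self_pow_le (n t : nat) : 'C(n, t) * t ^ t <= (4 * n) ^ t.
Proof.
have ft : t ^ t <= 4 ^ t * t`!.
  have : t ^ t <= (2 * t) ^_ t.
    have H k : k <= t -> t ^ k <= (2 * t) ^_ k.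
      elim: k => [|k IHk] kt; first by rewrite ffactn0.
      by rewrite ffactnSr expnSr leq_mul ?IHk; lia.
    exact: H.
  move/leq_trans; apply; rewrite -bin_ffact leq_mul2r; apply/orP; right.
  rewrite -[4]/(2 ^ 2) -expnM.
  have [->//|t0] := posnP t.
  have := Pascal 1 1 (2 * t); rewrite addn1 => ->.
  have tlt : t < (2 * t).+1 by lia.
  by rewrite (bigD1 (Ordinal tlt)) //= !exp1n !muln1 leq_addr.
apply: leq_trans (leq_mul (leqnn _) ft) _.
rewrite mulnCA bin_ffact expnMn leq_mul2l; apply/orP; right.
elim: t {ft} => [|t IHt]; first by rewrite ffactn0.
by rewrite ffactnSr expnSr leq_mul// leq_subr.
Qed.

(** * Graphs *)

Section Completion.
Variable V : finType.
Implicit Types (E F : {set {set V}}) (U : {set V}).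

Lemma degree_setU1 E (e : {set V}) v :
  e \notin E -> degree (e |: E) v = degree E v + (v \in e).
Proof.
move=> eE; rewrite /degree; case ve: (v \in e).
  rewrite (cardsD1 e) !inE eqxx ve /= addnC; congr (_ + _).
  apply: eq_card => f; rewrite !inE; case: eqP => [->|] //=.
  by rewrite (negPf eE).
rewrite addn0; apply: eq_card => f; rewrite !inE; case: eqP => [->|] //=.
by rewrite ve andbF.
Qed.

Lemma degree_setD1 E (e : {set V}) v :
  e \in E -> degree (E :\ e) v + (v \in e) = degree E v.
Proof.
by move=> eE; rewrite -degree_setU1 ?setD1K// setD11.
Qed.

Lemma simple_graphP E :
  reflect (forall e, e \in E -> #|e| = 2) (simple_graph E).
Proof.
by apply: (iffP forall_inP) => H e eE; apply/eqP; rewrite ?H//; apply/eqP/H.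
Qed.

Lemma simple_adjacent E x y : simple_graph E -> [set x; y] \in E -> x != y.
Proof. by move=> /simple_graphP sE /sE; rewrite cards2; case: eqP. Qed.

Lemma adjacent_simple E x y :
  simple_graph E -> adjacent E x y = ([set x; y] \in E).
Proof.
move=> sE; rewrite /adjacent andbC; case xyE: (_ \in E) => //=.
exact: simple_adjacent xyE.
Qed.

Lemma adjacent_sym E : symmetric (adjacent E).
Proof. by move=> x y; rewrite /adjacent eq_sym setUC. Qed.

Lemma edge_endpoints E e x :
  simple_graph E -> e \in E -> x \in e ->
  exists2 y, x != y & e = [set x; y].
Proof.
move=> /simple_graphP sE /sE /eqP/cards2P[a [b [ab ->]]].
rewrite !inE => /orP[] /eqP xE; rewrite xE; first by exists b.
by exists a; rewrite 1?eq_sym// setUC.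
Qed.

Lemma set2_injr (x y z : V) : x != y -> [set x; y] = [set x; z] -> y = z.
Proof.
move=> xy /setP /(_ y); rewrite !inE eqxx orbT eq_sym (negPf xy) /=.
by move/esym/eqP.
Qed.

Lemma degree_adjacent E x :
  simple_graph E -> degree E x = #|[set y | adjacent E x y]|.
Proof.
move=> sE; rewrite /degree -(@card_in_imset _ _ (fun y => [set x; y])).
  apply: eq_card => e; rewrite !inE; apply/andP/imsetP.
    move=> [eE xe]; have [y xy Ee] := edge_endpoints sE eE xe.
    by exists y; rewrite // inE /adjacent xy -Ee.
  by case=> y; rewrite inE adjacent_simple// => xyE ->; rewrite xyE set21.
move=> y z; rewrite !inE => /andP[xy _] _; exact: set2_injr.
Qed.

Lemma sum_degree E : simple_graph E -> \sum_x degree E x = 2 * #|E|.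
Proof.
move=> /simple_graphP sE; rewrite /degree.
under eq_bigr => x _ do rewrite -sum1dep_card.
rewrite (exchange_big_dep (mem E)) /=; last by move=> x e _ /andP[].
rewrite mulnC -sum_nat_const; apply: eq_bigr => e eE.
by rewrite -(sE _ eE) -sum1_card; apply: eq_bigl => x; rewrite eE.
Qed.

Lemma degree_sub E F x : F \subset E -> degree F x <= degree E x.
Proof.
move=> FE; apply: subset_leq_card; apply/subsetP => e.
by rewrite !inE => /andP[/(subsetP FE) -> ->].
Qed.

Lemma simple_setU1 E x y :
  simple_graph E -> x != y -> simple_graph ([set x; y] |: E).
Proof.
move=> /simple_graphP sE xy; apply/simple_graphP => e /setU1P[->|/sE//].
by rewrite cards2 xy.
Qed.

(* Take a supergraph of F with degrees at most d and as many edges as possible.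
   Two deficient vertices u, v are joined in it, and for any edge x y outside F
   with x not joined to u and y not joined to v, replacing x y by u x and v y
   would add an edge. The same exchange with u = v covers a single vertex whose
   deficiency is at least 2. *)
Lemma regular_completion (d : nat) F :
  simple_graph F -> (forall v, degree F v <= d) -> ~~ odd (#|V| * d) ->
  3 * d ^ 2 < \sum_v (d - degree F v) ->
  exists2 E : {set {set V}}, F \subset E & regular_graph d E.
Proof.
move=> sF dF evn big.
pose P (E : {set {set V}}) :=
  [&& F \subset E, simple_graph E & [forall v, degree E v <= d]].
have PF : P F by rewrite /P subxx sF /=; apply/forallP.
have [E PE maxE] : exists2 E, P E & forall E', P E' -> #|E'| <= #|E|.
  exists (arg_max F P (fun E' : {set {set V}} => #|E'|));
  by case: arg_maxnP.
have /and3P[FE sE /forallP dE] := PE.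
exists E => //; rewrite /regular_graph sE /=.
apply/negPn/negP => /forallPn [u u_def].
have {u_def} u_def : degree E u < d by rewrite ltn_neqAle u_def dE.
have sumE : \sum_x (d - degree E x) + 2 * #|E| = #|V| * d.
  rewrite -sum_degree// -big_split /= (eq_bigr (fun=> d)) ?sum_nat_const//.
  by move=> x _; rewrite subnK.
(* Either another vertex is deficient or [u] itself lacks at least two edges: otherwise the total
   deficiency would be 1, against the parity of [|V| * d]. *)
have [v v_def] : exists v, degree E v + (u == v) < d.
  apply/existsP; apply: contraT; rewrite negb_exists => /forallP H.
  have H' v : d - degree E v = (v == u).
    by have := H v; have := dE v; rewrite eq_sym; case: eqP => [->|_] /=; lia.
  move: evn; rewrite -sumE (eq_bigr _ (fun v _ => H' v)).
  rewrite -big_mkcond /= big_pred1_eq.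
  by rewrite oddD /= mul2n odd_double.
have deg2 (w : V) : degree E w + (w == u) + (w == v) <= d.
  have := dE w; have := v_def; rewrite [w == v]eq_sym.
  case: (w =P u) => [->|wu]; case: (v =P _) => [vw|_]; rewrite ?vw ?eqxx; lia.
have joined w w' : degree E w < d -> degree E w' < d -> w != w' ->
    [set w; w'] \in E.
  move=> dw dw' ww'; apply/negPn/negP => nE.
  have : P ([set w; w'] |: E).
    rewrite /P simple_setU1// subsetU ?FE ?orbT //=.
    apply/forallP => x; rewrite degree_setU1// !inE.
    case: (x =P w) => [->|_]; first by rewrite addn1.
    by case: (x =P w') => [->|_] /=; rewrite ?addn1 ?addn0 ?dE.
  by move/maxE; rewrite cardsU1 nE /= add1n ltnn.
pose nb w := w |: [set y | adjacent E w y].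
have card_nb w : degree E w < d -> #|nb w| <= d.
  move=> dw; rewrite cardsU1 -degree_adjacent//.
  by case: (_ \notin _) => /=; lia.
(* Every deficient vertex is [u] or a neighbour of [u], and there are at most [d] of these. *)
have small_def : \sum_x (d - degree E x) <= d * d.
  rewrite (bigID (mem (nb u))) /= [X in _ + X]big1 ?addn0.
    apply: (@leq_trans (\sum_(x in nb u) d)).
      by apply: leq_sum => x _; exact: leq_subr.
    by rewrite sum_nat_const leq_mul2r card_nb ?orbT.
  move=> x; rewrite !inE negb_or => /andP[xu nxu]; apply/eqP; rewrite subn_eq0.
  rewrite leqNgt; apply: contra nxu => xd.
  by rewrite adjacent_simple// joined// eq_sym.
have sEF : simple_graph (E :\: F).
  by apply/simple_graphP => e /setDP[/(simple_graphP _ sE)].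
have degEF x : degree (E :\: F) x = degree E x - degree F x.
  have -> : degree F x = #|[set e in E | x \in e] :&: F|.
    apply: eq_card => e; rewrite !inE andbAC.
    by case eF: (e \in F); rewrite ?andbF//= (subsetP FE).
  rewrite -cardsDS; last exact: subsetIl.
  apply: eq_card => e; rewrite !inE.
  by case: (e \in E); case: (e \in F); case: (x \in e).
have many : 2 * (d * d) < \sum_x degree (E :\: F) x.
  have : \sum_x (d - degree F x) =
      \sum_x (d - degree E x) + \sum_x degree (E :\: F) x.
    rewrite -big_split; apply: eq_bigr => x _ /=.
    have := dE x; have := degree_sub x FE; rewrite degEF; lia.
  move: big small_def; rewrite expnS expn1; lia.
(* Each of [nb u] and [nb v] has at most [d] elements of degree at most [d], so the two conditions
   exclude at most [2 * (d * d)] ordered pairs, fewer than [E :\: F] offers. *)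
have [x [y [xyEF xu yv]]] : exists x y,
    [/\ [set x; y] \in E :\: F, x \notin nb u & y \notin nb v].
  have [/existsP[x /existsP[y /and3P[]]]|] := boolP [exists x, exists y,
    [&& [set x; y] \in E :\: F, x \notin nb u & y \notin nb v]].
    by exists x, y.
  rewrite negb_exists => /forallP none.
  suff : \sum_x degree (E :\: F) x <= 2 * (d * d) by rewrite leqNgt many.
  have bound w : degree E w < d -> \sum_(x in nb w) degree E x <= d * d.
    move=> dw; apply: (@leq_trans (\sum_(x in nb w) d)); first exact: leq_sum.
    by rewrite sum_nat_const leq_mul2r card_nb ?orbT.
  have dv : degree E v < d by apply: leq_ltn_trans v_def; exact: leq_addr.
  rewrite mul2n -addnn; apply: leq_trans (leq_add (bound u u_def) (bound v dv)).
  have -> : \sum_(y in nb v) degree E y =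
      \sum_x \sum_(y in nb v) adjacent E x y.
    rewrite exchange_big; apply: eq_bigr => y _.
    rewrite degree_adjacent// -sum1dep_card big_mkcond.
    by apply: eq_bigr => x _; rewrite adjacent_sym; case: adjacent.
  rewrite [X in _ <= X + _]big_mkcond -big_split; apply: leq_sum => x _ /=.
  case: ifP => xu.
    apply: leq_trans (leq_addr _ _); exact: degree_sub (subsetDl _ _).
  rewrite add0n degree_adjacent// -sum1dep_card big_mkcond [leqRHS]big_mkcond.
  apply: leq_sum => y _ /=; case: ifP => // xy; move: (none x).
  rewrite negb_exists => /forallP /(_ y).
  rewrite -adjacent_simple// xy xu /= negbK => ->.
  by move: xy; rewrite !adjacent_simple// inE => /andP[_ ->].
have /setDP[xyE xyF] := xyEF.
move: xu yv; rewrite !inE !negb_or !adjacent_simple// => /andP[xu uxE] /andP[yv vyE].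
have xy := simple_adjacent sE xyE.
have uxvy : [set u; x] != [set v; y].
  apply/eqP => /setP H.
  have /eqP xv : x == v.
    by have := H x; rewrite !inE eqxx orbT (negPf xy) orbF => <-.
  have /eqP yu : y == u.
    by have := H y; rewrite !inE eqxx orbT [y == x]eq_sym (negPf xy) orbF => ->.
  by move: uxE; rewrite -yu setUC xyE.
have vyE' : [set v; y] \notin E :\ [set x; y] by rewrite !inE (negPf vyE) andbF.
have uxE' : [set u; x] \notin [set v; y] |: (E :\ [set x; y]).
  by rewrite !inE (negPf uxvy) (negPf uxE) andbF.
have : P ([set u; x] |: ([set v; y] |: (E :\ [set x; y]))).
  apply/and3P; split.
  - apply/subsetP => e eF; rewrite !inE (subsetP FE) // andbT.
    by case: (e =P [set x; y]) xyF => [<-|_ _]; rewrite ?eF ?orbT.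
  - apply: simple_setU1; last by rewrite eq_sym.
    apply: simple_setU1; last by rewrite eq_sym.
    by apply/simple_graphP => e /setD1P[_ /(simple_graphP _ sE)].
  - apply/forallP => w; rewrite !degree_setU1//.
    have := deg2 w; rewrite -(degree_setD1 w xyE) !inE.
    move: (degree _ w) => D.
    case: (w =P x) => [->|_].
      by rewrite (negPf xu) (negPf xy) /= ?orbF addn0 addnAC.
    case: (w =P y) => [->|_].
      by rewrite (negPf yv) /= ?orbF addn0.
    by rewrite !orbF addn0 addnAC.
move/maxE; rewrite !cardsU1 uxE' vyE' /= (cardsD1 [set x; y] E) xyE /=.
by rewrite !add1n ltnn.
Qed.
End Completion.

Local Open Scope ring_scope.

(** * Expanders *)

Lemma perms_into_le (V : finType) (C S T : {set V}) :
  S \subset C -> T \subset C -> (0 < #|C|)%N ->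
  (#|perms_into C S T|%:R : rat) <= (#|C|`!)%:R * (#|T|%:R / #|C|%:R) ^+ #|S|.
Proof.
move=> SC TC C0; rewrite expr_div_n mulrA ler_pdivlMr; last first.
  by rewrite exprn_gt0// ltr0n.
rewrite -!natrX -!natrM ler_nat.
have ff0 : (0 < #|C| ^_ #|S|)%N by rewrite ffact_gt0 subset_leq_card.
rewrite -(leq_pmul2r ff0) mulnAC card_perms_into// mulnAC.
rewrite -[leqRHS]mulnA mulnC leq_mul2l; apply/orP; right.
by rewrite ffact_ratio_le// subset_leq_card.
Qed.

Lemma sum_quarter_pow_lt (n : nat) :
  \sum_(t < n.+1 | (0 < t)%N) (4%:R^-1 : rat) ^+ t < 1.
Proof.
rewrite big_mkcond big_ord_recl /= add0r.
under eq_bigr do rewrite /bump /= add1n.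
suff -> : \sum_(i < n) (4%:R^-1 : rat) ^+ i.+1 = 3%:R^-1 * (1 - 4%:R^-1 ^+ n).
  have : 0 < (4%:R^-1 : rat) ^+ n by rewrite exprn_gt0.
  lra.
elim: n => [|n IHn]; first by rewrite big_ord0 expr0 subrr mulr0.
rewrite big_ord_recr /= IHn exprS; lra.
Qed.

Lemma three_quarters_pow15 (F : realFieldType) :
  (3%:R / 4%:R : F) ^+ 15 <= 32%:R^-1.
Proof.
have -> : (32%:R^-1 : F) = 2%:R^-1 ^+ 5 by field.
have h : (3%:R / 4%:R : F) ^+ 3 <= 2%:R^-1 by rewrite !exprS expr0; lra.
by rewrite (exprM _ 3 5); apply: lerXn2r; rewrite ?nnegrE ?exprn_ge0 ?divr_ge0 ?invr_ge0.
Qed.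

(** Union bound over pairs [(T, S)], where [S] is a non-expanding set and [T] contains [S] and all
    its images. With [t = |T|] the expected number of such pairs is at most the sum over [t] of
    ['C(N, t) * 2^t * (t / N)^(16 t)]. *)
Lemma expander_perms (V : finType) (C : {set V}) :
  exists f : {ffun 'I_24 -> {perm V}}, (forall j, perm_on C (f j)) /\
  forall S : {set V}, S \subset C -> (2 * #|S| <= #|C|)%N ->
    (#|S| <= 2 * #|(\bigcup_j f j @: S) :\: S|)%N.
Proof.
pose N := #|C|.
have [N0|Npos] := posnP N.
  exists [ffun=> 1%g]; split; first by move=> j; rewrite ffunE perm_on1.
  move=> S SC _; have -> : S = set0.
    by apply/eqP; rewrite -subset0 -(cards0_eq N0).
  by rewrite cards0.
(* If [S] fails to expand, [T = S :|: B] has fewer than [3/2 |S|] elements, hence at most [3/4 N]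
   since [S] is at most half of [C]. *)
pose P (T : {set V}) := [&& T \subset C, (0 < #|T|)%N & (4 * #|T| <= 3 * N)%N].
pose Q : pred ({set V} * {set V}) := fun q =>
  [&& P q.1, q.2 \subset q.1 & (2 * #|q.1| <= 3 * #|q.2|)%N].
pose bad (q : {set V} * {set V}) : {set {ffun 'I_24 -> {perm V}}} :=
  [set f in ffun_on (mem (perms_into C q.2 q.1))].
pose all_f : {set {ffun 'I_24 -> {perm V}}} := [set f in ffun_on (perm_on C)].
have card_all : #|all_f| = (N`! ^ 24)%N.
  by rewrite cardsE card_ffun_on card_ord card_perm.
suff few : (#|\bigcup_(q | Q q) bad q| < #|all_f|)%N.
  have /subsetPn[f fall fbad] : ~~ (all_f \subset \bigcup_(q | Q q) bad q).
    by apply/negP => /subset_leq_card; rewrite leqNgt few.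
  move: fall; rewrite inE => /ffun_onP fC0; have fC j : perm_on C (f j) by exact: fC0.
  exists f; split => // S SC SN; rewrite leqNgt; apply/negP => small.
  move/bigcupP: fbad; apply.
  set B := \bigcup_j f j @: S in small *; exists (S :|: B, S).
    have cardSB : (#|S :|: B| = #|S| + #|B :\: S|)%N.
      by rewrite -(cardsID S (S :|: B)) setUK setDUl setDv set0U.
    rewrite /Q /P /= subsetUl cardSB; apply/and3P; split=> //; last by lia.
    apply/and3P; split; [|lia|rewrite /N; lia].
    rewrite subUset SC; apply/bigcupsP => j _; apply/subsetP => _ /imsetP[x xS ->].
    by rewrite (perm_closed _ (fC j)) (subsetP SC).
  rewrite inE; apply/ffun_onP => j; rewrite /= inE (fC j) /=.
  by apply: subset_trans (subsetUr _ _); exact: (bigcup_sup j).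
pose y (t : nat) : rat := t%:R / N%:R.
have N0r : 0 < (N%:R : rat) by rewrite ltr0n.
have y0 t : 0 <= y t by rewrite divr_ge0.
have le_sum : (#|\bigcup_(q | Q q) bad q| <= \sum_(q | Q q) #|bad q|)%N.
  elim/big_ind2: _ => [|a A b B Aa Bb|//]; first by rewrite cards0.
  by rewrite (leq_trans (leq_card_setU A B))// leq_add.
apply: leq_ltn_trans le_sum _.
rewrite -(ltr_nat rat) natr_sum card_all natrX.
have Nf0 : 0 < (N`!%:R : rat) ^+ 24 by rewrite exprn_gt0// ltr0n fact_gt0.
(* The 24 permutations give the exponent [24 |S|], which is at least [16 |T|]. *)
have term q : Q q ->
    (#|bad q|%:R : rat) <= N`!%:R ^+ 24 * y #|q.1| ^+ (16 * #|q.1|).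
  case: q => T S; rewrite /Q /P /= => /and3P[/and3P[TC T0 TN] ST tS].
  rewrite cardsE card_ffun_on card_ord natrX.
  have SC := subset_trans ST TC.
  apply: (@le_trans _ _ ((N`!%:R * y #|T| ^+ #|S|) ^+ 24)).
    by apply: lerXn2r; rewrite ?nnegrE ?mulr_ge0 ?exprn_ge0//; exact: perms_into_le.
  rewrite exprMn ler_pM2l// -exprM ler_wiXn2l//; last by lia.
  by rewrite ler_pdivrMr// mul1r ler_nat subset_leq_card.
apply: le_lt_trans (ler_sum _ term) _.
rewrite -mulr_sumr -[ltRHS]mulr1 ltr_pM2l//.
apply: (@le_lt_trans _ _ (\sum_(T | P T) \sum_(S : {set V} | S \subset T)
    y #|T| ^+ (16 * #|T|))).
  rewrite pair_big_dep /= big_mkcond [leRHS]big_mkcond; apply: ler_sum => -[T S] _.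
  rewrite /Q /=; case: (P T) => //=; case: (S \subset T) => //=.
  by case: ifP => // _; rewrite exprn_ge0.
apply: (@le_lt_trans _ _ (\sum_(T | P T) (2%:R * y #|T| ^+ 16) ^+ #|T|)).
  apply: ler_sum => T _; rewrite sumr_const [leRHS]exprMn -exprM.
  have -> : #|[pred S : {set V} | S \subset T]| = (2 ^ #|T|)%N.
    by rewrite -card_powerset; apply: eq_card => S; rewrite !inE.
  by rewrite -[leLHS]mulr_natl natrX.
apply: le_lt_trans (sum_quarter_pow_lt N).
rewrite (partition_big (fun T : {set V} => inord #|T| : 'I_N.+1)
  (fun t => (0 < t)%N && (4 * t <= 3 * N)%N)) /=; last first.
  by move=> T /and3P[TC T0 TN]; rewrite inordK ?T0// ltnS subset_leq_card.
rewrite big_mkcond [leRHS]big_mkcond; apply: ler_sum => t _.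
case: (posnP t) => //= t0; case: ifP => // tN; last by rewrite exprn_ge0.
apply: (@le_trans _ _
    (\sum_(T in [set T : {set V} | T \subset C & #|T| == t])
       (2%:R * y t ^+ 16) ^+ t)).
  rewrite big_mkcond [leRHS]big_mkcond; apply: ler_sum => T _.
  rewrite inE /P; case TC: (T \subset C) => //=.
  rewrite -(inj_eq val_inj) /= inordK ?ltnS ?subset_leq_card//.
  case: eqP => [->|_]; last by rewrite andbF.
  by rewrite t0 tN lexx.
rewrite sumr_const cards_draws -/N -[leLHS]mulr_natl.
(* One of the 16 factors [(t / N)^t] cancels the binomial up to [4^t]. What remains is the [t]-th
   power of [8 (t / N)^15 <= 8 (3/4)^15 <= 8/32 = 1/4]. *)
have binle : ('C(N, t))%:R * y t ^+ t <= 4%:R ^+ t.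
  rewrite expr_div_n mulrA ler_pdivrMr ?exprn_gt0// -exprMn -!natrX -!natrM.
  by rewrite -natrX ler_nat bin_self_pow_le.
have -> : (2%:R * y t ^+ 16) ^+ t = y t ^+ t * (2%:R * y t ^+ 15) ^+ t.
  by rewrite -exprMn exprS mulrCA.
rewrite [leLHS]mulrA.
apply: le_trans (ler_wpM2r _ binle) _.
  by apply: exprn_ge0; apply: mulr_ge0 => //; apply: exprn_ge0.
rewrite -exprMn; apply: lerXn2r; rewrite ?nnegrE ?invr_ge0//.
  by apply: mulr_ge0 => //; apply: mulr_ge0 => //; apply: exprn_ge0.
have : y t ^+ 15 <= (3%:R / 4%:R) ^+ 15.
  apply: lerXn2r; rewrite ?nnegrE ?divr_ge0// ler_pdivrMr// mulrAC.
  by rewrite ler_pdivlMr// -!natrM ler_nat mulnC.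
have := three_quarters_pow15 rat.
lra.
Qed.

(** * The random graph process *)

(** Chebyshev's inequality for the number [X] of events that occur. Pairs are not positively
    correlated, so the variance is at most the mean [k * a], while [X] deviates from its mean by
    [k * a] wherever no event occurs. *)
Lemma second_moment_bound (R : realFieldType) (Om : finType) (k : nat)
    (A : 'I_k -> {set Om}) (a : R) :
  0 < a -> (0 < k)%N ->
  (forall j, #|A j|%:R = a * #|Om|%:R) ->
  (forall i j, i != j -> #|A i :&: A j|%:R <= a ^+ 2 * #|Om|%:R) ->
  #|[set x | [forall j, x \notin A j]]|%:R <= #|Om|%:R / (k%:R * a).
Proof.
move=> a0 k0 A1 A2; set Z := [set x | _]; set w : R := #|Om|%:R.
have kr0 : 0 < (k%:R : R) by rewrite ltr0n.
pose X (x : Om) : R := \sum_j (x \in A j)%:R.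
have sumI (B : {set Om}) : \sum_x ((x \in B)%:R : R) = #|B|%:R.
  by rewrite -sum1_card natr_sum [RHS]big_mkcond; apply: eq_bigr => x _; case: (x \in B).
have EX : \sum_x X x = k%:R * (a * w).
  rewrite exchange_big (eq_bigr (fun=> a * w)) => [|j _]; last by rewrite sumI A1.
  by rewrite sumr_const card_ord -[LHS]mulr_natl.
have EX2 : \sum_x X x ^+ 2 <= k%:R * (a * w) + k%:R ^+ 2 * (a ^+ 2 * w).
  have -> : \sum_x X x ^+ 2 = \sum_i \sum_j (#|A i :&: A j|%:R : R).
    under eq_bigr => x _ do rewrite expr2 mulr_suml.
    rewrite exchange_big; apply: eq_bigr => i _.
    under eq_bigr => x _ do rewrite mulr_sumr.
    rewrite exchange_big; apply: eq_bigr => j _.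
    by rewrite -sumI; apply: eq_bigr => x _; rewrite inE -natrM mulnb.
  have -> : k%:R * (a * w) + k%:R ^+ 2 * (a ^+ 2 * w) =
      \sum_(i < k) (a * w + \sum_(j < k) a ^+ 2 * w).
    rewrite big_split /= !sumr_const card_ord.
    rewrite -(mulr_natl (a * w) k) -(mulr_natl (a ^+ 2 * w) k).
    by rewrite -(mulr_natl (k%:R * (a ^+ 2 * w)) k); ring.
  apply: ler_sum => i _; rewrite (bigD1 i) //= setIid A1 lerD2l.
  rewrite [leRHS](bigD1 i) //= -[leLHS]add0r lerD//.
    by apply: mulr_ge0; [apply/exprn_ge0/ltW | apply: ler0n].
  by apply: ler_sum => j ji; rewrite A2// eq_sym.
have dev : #|Z|%:R * (k%:R * a) ^+ 2 <= \sum_x (X x - k%:R * a) ^+ 2.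
  rewrite -sumI mulr_suml; apply: ler_sum => x _.
  case xZ: (x \in Z); last by rewrite mul0r sqr_ge0.
  suff -> : X x = 0 by rewrite sub0r sqrrN mul1r.
  apply: big1 => j _; move: xZ; rewrite inE => /forallP /(_ j).
  by case: (x \in A j).
have dev' : \sum_x (X x - k%:R * a) ^+ 2 <= k%:R * (a * w).
  have -> : \sum_x (X x - k%:R * a) ^+ 2 =
      \sum_x X x ^+ 2 - 2%:R * (k%:R * a) * \sum_x X x + w * (k%:R * a) ^+ 2.
    have -> : w * (k%:R * a) ^+ 2 = \sum_(x : Om) (k%:R * a) ^+ 2.
      by rewrite sumr_const -[RHS]mulr_natl.
    rewrite mulr_sumr -sumrB -big_split /=.
    by apply: eq_bigr => x _; ring.
  rewrite EX; lra.
rewrite ler_pdivlMr ?mulr_gt0// -(ler_pM2r (mulr_gt0 kr0 a0)).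
by have := le_trans dev dev'; lra.
Qed.

Section ProcessOrders.
Variables (R : realType) (V : finType) (E : {set {set V}}).
Implicit Types (s : #|E|.-tuple {set V}) (p : {perm 'I_#|E|}).

(* The edge of index i in [enum E] is added at step p i. *)
Definition process_order p : #|E|.-tuple {set V} :=
  [tuple enum_val ((p^-1)%g i) | i < #|E|].

Lemma tnth_process_order p i : tnth (process_order p) i = enum_val ((p^-1)%g i).
Proof. by rewrite tnth_mktuple. Qed.

Lemma mem_process_graph s (t : nat) e :
  reflect (exists2 i : 'I_#|E|, (i < t)%N & tnth s i = e)
    (e \in process_graph s t).
Proof.
rewrite inE; apply: (iffP idP) => [es|[i it <-]].
  have := es; rewrite -index_mem size_take_min size_tuple leq_min => /andP[it iE].
  exists (Ordinal iE) => //; rewrite (tnth_nth e) /=.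
  by rewrite -(nth_take e it) nth_index.
rewrite (tnth_nth (tnth s i)) -(nth_take _ it) mem_nth//.
by rewrite size_take_min size_tuple leq_min it ltn_ord.
Qed.

Lemma process_weight_uniq s : uniq s -> {subset s <= E} ->
  process_weight R s = (#|E|`!)%:R^-1.
Proof.
move=> us sE; rewrite /process_weight.
transitivity (\prod_(i < #|E|) ((#|E| - i)%:R^-1 : R)).
  apply: eq_bigr => i _.
  have cg : #|process_graph s i| = i.
    rewrite cardsE (card_uniqP (take_uniq _ us)) size_take_min size_tuple.
    by apply/minn_idPl/ltnW.
  have gE : process_graph s i \subset E.
    by apply/subsetP => e; rewrite inE => /mem_take/sE.
  rewrite inE sE ?mem_tnth// andbT.
  case: (mem_process_graph s i (tnth s i)) => [[j ji /(tuple_uniqP _ us) jE]|_] /=.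
    by move: ji; rewrite jE ltnn.
  by rewrite cardsDS// cg.
by rewrite prodfV -natr_prod -ffact_prod ffactnn.
Qed.

(** A repeated edge or an edge outside [E] makes a factor vanish, so the tuple must enumerate
    [E]. *)
Lemma process_weight_neq0 s : process_weight R s != 0 ->
  exists p, s = process_order p.
Proof.
move=> /prodf_neq0 H.
have sE i : tnth s i \in E /\ tnth s i \notin process_graph s i.
  have := H i isT; case: ifP => [|_]; last by rewrite eqxx.
  by rewrite inE => /andP[].
have inj_s : injective (tnth s).
  move=> i j; wlog lt_ij : i j / (i < j)%N => [W|] ij.
    have [lt|lt|/val_inj//] := ltngtP i j; first exact: W.
    by apply/esym/W.
  have [_ /negP] := sE j; case; apply/mem_process_graph; by exists i.
pose g i := enum_rank_in (sE i).1 (tnth s i).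
have gK i : enum_val (g i) = tnth s i by rewrite enum_rankK_in// (sE i).1.
have g_inj : injective g.
  by move=> i j ij; apply: inj_s; rewrite -!gK ij.
exists (perm g_inj)^-1%g; apply: eq_from_tnth => i.
by rewrite tnth_process_order invgK permE gK.
Qed.

Lemma process_order_inj : injective process_order.
Proof.
move=> p q pq; apply: invg_inj; apply/permP => i.
by apply: enum_val_inj; rewrite -!tnth_process_order pq.
Qed.

(** All [|E|!] orders of the edges carry the same weight and every other tuple has weight 0. The
    process is thus a uniform permutation, and probabilities become counts. *)
Lemma process_prob_card (A : pred (#|E|.-tuple {set V})) :
  process_prob R A = #|[set p | A (process_order p)]|%:R / (#|E|`!)%:R.
Proof.
rewrite /process_prob mulr_natl -sumr_const.
rewrite (bigID (fun s => s \in process_order @: [set: {perm 'I_#|E|}])) /=.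
rewrite [X in _ + X]big1 ?addr0 => [|s /andP[_ sO]]; last first.
  apply/eqP; apply: contraNT sO => /process_weight_neq0[p ->].
  by rewrite imset_f ?inE.
rewrite (eq_bigl (mem (process_order @: [set p | A (process_order p)]))).
  rewrite big_imset /=; last by move=> p q _ _; exact: process_order_inj.
  apply: eq_bigr => p _; apply: process_weight_uniq.
    by rewrite map_inj_uniq ?enum_uniq// => i j /enum_val_inj/perm_inj.
  by move=> e /mapP[i _ ->]; exact: enum_valP.
move=> s /=; apply/andP/imsetP => [[As /imsetP[p _ sp]]|[p]].
  by exists p; rewrite // inE -sp.
by rewrite inE => Ap ->; rewrite Ap imset_f ?inE.
Qed.

Definition avoids s (t : nat) (B : {set {set V}}) : bool :=
  [disjoint process_graph s t & B].

(** [B] is avoided up to step [t] exactly when the permutation sends the indices of its edges into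
    the steps from [t] on, so [card_perms_into] applies. *)
Lemma card_avoids (t : nat) (B : {set {set V}}) : B \subset E ->
  (#|[set p | avoids (process_order p) t B]| * #|E| ^_ #|B| =
   (#|E| - t) ^_ #|B| * #|E|`!)%N.
Proof.
move=> BE; pose Br := [set k : 'I_#|E| | enum_val k \in B].
pose late := [set i : 'I_#|E| | (t <= i)%N].
have cB : #|Br| = #|B|.
  rewrite -(card_imset _ enum_val_inj); apply: eq_card => e.
  apply/imsetP/idP => [[k + ->]|eB]; first by rewrite inE.
  have eE := subsetP BE _ eB.
  exists (enum_rank_in eE e); rewrite ?inE enum_rankK_in//.
have cl : #|late| = (#|E| - t)%N.
  rewrite -sum1dep_card -(big_geq_mkord t #|E| predT (fun=> 1%N)).
  by rewrite sum_nat_const_nat muln1.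
have -> : [set p | avoids (process_order p) t B] = perms_into setT Br late.
  apply/setP => p; rewrite !inE /avoids.
  have -> /= : perm_on setT p by apply/subsetP => i; rewrite inE.
  apply/pred0P/subsetP => [H _ /imsetP[k kB ->]|H e].
    rewrite inE leqNgt; apply/negP => pk; move: (H (enum_val k)) => /=.
    move: kB; rewrite inE => ->; rewrite andbT => /negP; apply.
    by apply/mem_process_graph; exists (p k); rewrite // tnth_process_order permK.
  apply/negP => /= /andP[/mem_process_graph[i it]]; rewrite tnth_process_order.
  move=> <- eB; have := H (p ((p^-1)%g i)); rewrite permKV inE leqNgt it /=.
  by move=> Hi; have := Hi; rewrite -{1}[i](permKV p) imset_f ?inE// => /(_ isT).
by have := card_perms_into (subsetT Br) (subsetT late); rewrite cardsT card_ord cB cl.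
Qed.

End ProcessOrders.

Lemma ffact_add (n b c : nat) : (n ^_ (b + c) = n ^_ b * (n - b) ^_ c)%N.
Proof.
elim: c => [|c IHc]; first by rewrite addn0 ffactn0 muln1.
by rewrite addnS !ffactnSr IHc subnDA mulnA.
Qed.

(** Negative correlation: two disjoint [b]-sets are both missed by a random choice without
    replacement with probability at most the square of that for one. Factor by factor, [(L - b - k)
    / (M - b - k) <= (L - k) / (M - k)]. *)
Lemma ffact_double_ratio (L M b : nat) : (L <= M)%N ->
  (L ^_ (b + b) * (M ^_ b * M ^_ b) <= L ^_ b * L ^_ b * M ^_ (b + b))%N.
Proof.
move=> LM; have key k : (b + k <= M)%N ->
    ((L - b) ^_ k * M ^_ k <= L ^_ k * (M - b) ^_ k)%N.
  elim: k => [|k IHk] bkM; first by rewrite !ffactn0.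
  rewrite !ffactnSr.
  have step : ((L - b - k) * (M - k) <= (L - k) * (M - b - k))%N by nia.
  have := leq_mul (IHk (leq_trans (leq_add (leqnn b) (leqnSn k)) bkM)) step.
  by rewrite mulnACA [X in (_ <= X)%N]mulnACA.
have [Mb|bM] := ltnP M (b + b); first by rewrite ffact_small// (leq_ltn_trans LM).
rewrite !ffact_add mulnACA [X in (_ <= X)%N]mulnACA leq_mul//.
exact: key.
Qed.

Lemma card_pair_cap (V : finType) (U : {set V}) (a b : V) :
  a != b -> #|[set a; b] :&: U| = ((a \in U) + (b \in U))%N.
Proof.
move=> ab; rewrite -sum1_card (eq_bigl (fun x => (x \in [set a; b]) && (x \in U))).
  rewrite big_mkcondr /= big_setU1 ?inE// big_set1.
  by case: (a \in U); case: (b \in U).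
by move=> x; rewrite inE.
Qed.

(** * Isolated vertices, cut-off sets and the two hitting times *)

Section HittingTimes.
Variables (V : finType) (E : {set {set V}}).

(** The edge set whose cardinality is [edge_boundary E U] by conversion; likewise [degree E v] is
    the cardinality of [star v]. *)
Definition cut (U : {set V}) : {set {set V}} := [set e in E | #|e :&: U| == 1%N].

Definition star (v : V) : {set {set V}} := [set e in E | v \in e].

Lemma process_order_sub (p : {perm 'I_#|E|}) (t : nat) :
  process_graph (process_order p) t \subset E.
Proof.
apply/subsetP => e; rewrite inE => /mem_take /mapP[i _ ->]; exact: enum_valP.
Qed.

Lemma process_graphS (s : #|E|.-tuple {set V}) (i t : nat) :
  (i <= t)%N -> process_graph s i \subset process_graph s t.
Proof.
move=> it; apply/subsetP => e /mem_process_graph[j ji <-].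
by apply/mem_process_graph; exists j => //; exact: leq_trans it.
Qed.

Lemma tau_1_le (p : {perm 'I_#|E|}) (t : nat) : (t <= #|E|)%N ->
  (forall v, ~~ avoids (process_order p) t (star v)) ->
  (tau_1 (process_order p) <= t)%N.
Proof.
move=> tE hv; rewrite leqNgt; apply/negP => lt_t.
have := before_find 0%N lt_t; rewrite nth_iota ?ltnS// add0n => /negP; apply.
apply/forallP => v; have := hv v; rewrite /avoids -setI_eq0.
case/set0Pn => e /setIP[eG]; rewrite inE => /andP[_ ve].
by apply/card_gt0P; exists e; rewrite inE eG.
Qed.

Lemma tau_conn_gt (p : {perm 'I_#|E|}) (t : nat) (U : {set V}) (x y : V) :
  simple_graph E -> (t <= #|E|)%N -> x \in U -> y \notin U ->
  avoids (process_order p) t (cut U) ->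
  (t < tau_conn (process_order p))%N.
Proof.
move=> sE tE xU yU av.
have disc (i : nat) : (i <= t)%N ->
    ~~ connected_graph (process_graph (process_order p) i).
  move=> it; apply/negP => /forallP/(_ x)/forallP/(_ y).
  move/(@closed_connect _ _ (mem U)) => /=.
  rewrite xU (negPf yU) => H; suff: true = false by []; apply: H.
  move=> a b; rewrite /adjacent => /andP[ab abG].
  have abE := subsetP (process_order_sub p i) _ abG.
  have := disjointFr av (subsetP (process_graphS _ it) _ abG).
  rewrite inE abE card_pair_cap//= => h; change ((a \in U) = (b \in U)).
  by move: h; case: (a \in U); case: (b \in U).
rewrite ltnNge; apply/negP => le_t.
(* Since [t <= |E|], a hitting time at most [t] is not the value [|E|.+1] standing for infinity, so
   the graph at that time really is connected. *)
have hasC : has (fun i => connected_graph (process_graph (process_order p) i))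
    (iota 0 #|E|.+1).
  by rewrite has_find size_iota ltnS (leq_trans le_t).
have := nth_find 0%N hasC; rewrite nth_iota ?add0n; last first.
  by rewrite ltnS (leq_trans le_t).
by apply/negP; exact: disc.
Qed.

(** At time [t], a union bound over the stars controls isolated vertices, and [second_moment_bound]
    over the disjoint cuts controls the event that no [U j] is cut off. Outside both events
    [tau_1 <= t < tau_conn]. *)
Lemma process_prob_tau_lt (R : realType) (d b k t : nat) (U : 'I_k -> {set V}) :
  regular_graph d E -> (0 < k)%N -> (t <= #|E|)%N -> (b <= #|E| - t)%N ->
  (forall j, U j != set0) -> (forall j, U j != setT) ->
  (forall j, #|cut (U j)| = b) ->
  (forall i j, i != j -> [disjoint cut (U i) & cut (U j)]) ->
  1 - #|V|%:R * (((#|E| - t) ^_ d)%:R / (#|E| ^_ d)%:R)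
    - (k%:R * (((#|E| - t) ^_ b)%:R / (#|E| ^_ b)%:R))^-1
  <= process_prob R (fun s : #|E|.-tuple {set V} => (tau_1 s < tau_conn s)%N).
Proof.
move=> /andP[sE /forallP regE] k0 tE bL U0 UT cutb cutd.
set M := #|E|; set L := (M - t)%N.
pose a (c : nat) : R := (L ^_ c)%:R / (M ^_ c)%:R.
pose av (B : {set {set V}}) : {set {perm 'I_M}} :=
  [set p | avoids (process_order p) t B].
have cardOm : #|{: {perm 'I_M}}| = M`! by rewrite card_Sn.
have M0 : 0 < (M`!%:R : R) by rewrite ltr0n fact_gt0.
have card_av (B : {set {set V}}) : B \subset E -> #|av B|%:R = a #|B| * M`!%:R.
  move=> BE; have ff0 : ((M ^_ #|B|)%:R : R) != 0.
    by rewrite pnatr_eq0 -lt0n ffact_gt0 subset_leq_card.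
  by apply: (mulIf ff0); rewrite -natrM card_avoids// natrM /a; field.
have cutE U' : cut U' \subset E by apply/subsetP => e; rewrite inE => /andP[].
have starE v : star v \subset E by apply/subsetP => e; rewrite inE => /andP[].
have star_d v : #|star v| = d by apply/eqP; exact: regE.
pose none : {set {perm 'I_M}} := [set p | [forall j, p \notin av (cut (U j))]].
pose bad := \bigcup_v av (star v) :|: none.
have good_bad : #|[set p : {perm 'I_M} |
      (tau_1 (process_order p) < tau_conn (process_order p))%N]|%:R
    >= M`!%:R - #|bad|%:R :> R.
  rewrite lerBlDr -natrD -cardOm ler_nat -cardsT.
  apply: leq_trans (leq_card_setU _ _); apply/subset_leq_card/subsetP => p _.
  rewrite !inE; apply/orP.
  have [pb|pb] := boolP (p \in bad).
    by right; move: pb; rewrite /bad !inE.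
  left; move: pb; rewrite /bad !inE negb_or negb_forall => /andP[pb /existsP[j]].
  rewrite negbK inE => avj.
  have [x xU] : exists x, x \in U j by apply/set0Pn.
  have [y yU] : exists y, y \notin U j.
    have := UT j; rewrite -subTset => /subsetPn[y _ yU]; by exists y.
  apply: leq_ltn_trans (tau_conn_gt sE tE xU yU avj).
  apply: tau_1_le => // v; apply: contra pb => avv.
  by apply/bigcupP; exists v => //; rewrite inE.
have star_le : #|\bigcup_v av (star v)|%:R <= #|V|%:R * (a d * M`!%:R).
  apply: (@le_trans _ _ (\sum_(v : V) #|av (star v)|%:R)).
    rewrite -natr_sum ler_nat; elim/big_ind2: _ => [|x A y B Ax By|//].
      by rewrite cards0.
    by rewrite (leq_trans (leq_card_setU A B))// leq_add.
  rewrite (eq_bigr (fun=> a d * M`!%:R)) => [|v _].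
    by rewrite sumr_const -[leLHS]mulr_natl.
  by rewrite card_av// star_d.
have bM : (b <= M)%N by rewrite (leq_trans bL)// leq_subr.
have ab0 : 0 < a b by rewrite divr_gt0// ltr0n ffact_gt0.
have none_le : #|none|%:R <= M`!%:R / (k%:R * a b).
  rewrite -cardOm; apply: second_moment_bound => // [j|i j ij].
    by rewrite card_av// cutb cardOm.
  have -> : av (cut (U i)) :&: av (cut (U j)) = av (cut (U i) :|: cut (U j)).
    apply/setP => p; rewrite !inE /avoids.
    by rewrite -!setI_eq0 setIUr setU_eq0.
  rewrite card_av ?subUset ?cutE// cardOm cardsU disjoint_setI0 ?cutd// cards0 subn0 !cutb.
  rewrite ler_pM2r// /a expr_div_n ler_pdivrMr; last first.
    have : cut (U i) :|: cut (U j) \subset E by rewrite subUset !cutE.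
    move/subset_leq_card; rewrite cardsU disjoint_setI0 ?cutd// cards0 subn0 !cutb.
    by move=> bbM; rewrite ltr0n ffact_gt0.
  rewrite mulrAC ler_pdivlMr; last by rewrite exprn_gt0// ltr0n ffact_gt0.
  rewrite -!natrX -!natrM ler_nat -!mulnn; apply: ffact_double_ratio.
  exact: leq_subr.
rewrite process_prob_card -/M ler_pdivlMr//.
apply: le_trans good_bad.
have : #|bad|%:R <= #|\bigcup_v av (star v)|%:R + #|none|%:R :> R.
  by rewrite -natrD ler_nat leq_card_setU.
rewrite -/(a d) -/(a b); move: star_le none_le; lra.
Qed.

End HittingTimes.

Local Close Scope ring_scope.

(** * The construction *)

(** Each boundary edge is oriented from [U] outwards, so the boundary can be split by the kind of
    edge and by the starting vertex. *)
Lemma edge_boundary_sum (V : finType) (E : {set {set V}}) (U : {set V}) :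
  simple_graph E ->
  edge_boundary E U = \sum_(x in U) \sum_(y in ~: U) ([set x; y] \in E).
Proof.
move=> sE; rewrite pair_big /=.
rewrite (eq_bigr (fun p : V * V => if [set p.1; p.2] \in E then 1 else 0)) => [|p _].
  rewrite -big_mkcondr sum1dep_card /edge_boundary.
  rewrite -(@card_in_imset _ _ (fun p : V * V => [set p.1; p.2])).
    apply: eq_card => e; rewrite !inE; apply/andP/imsetP.
      case=> eE /cards1P[x Ex].
      have /setIP[xe xU] : x \in e :&: U by rewrite Ex set11.
      have [y xy Ee] := edge_endpoints sE eE xe.
      exists (x, y) => //; rewrite !inE xU -Ee eE andbT /=.
      apply: contra xy => yU; have : y \in e :&: U by rewrite inE Ee set22.
      by rewrite Ex inE eq_sym.
    case=> -[x y]; rewrite !inE => /andP[/andP[xU yU] xyE] -> /=.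
    by rewrite xyE card_pair_cap ?(simple_adjacent sE)// xU (negPf yU).
  move=> [x y] [x' y']; rewrite !inE /= => /andP[/andP[xU yU] xyE].
  move=> /andP[/andP[xU' yU'] _] eqE.
  have xx' : x = x'.
    have : x \in [set x'; y'] by rewrite -eqE set21.
    rewrite !inE => /orP[/eqP//|/eqP xy']; by rewrite -xy' xU in yU'.
  rewrite -xx' in eqE *; congr pair.
  exact: set2_injr (simple_adjacent sE xyE) eqE.
by case: (_ \in E).
Qed.

Lemma edge_boundary_sub (V : finType) (F E : {set {set V}}) (U : {set V}) :
  F \subset E -> edge_boundary F U <= edge_boundary E U.
Proof.
move=> FE; apply: subset_leq_card; apply/subsetP => e.
by rewrite !inE => /andP[/(subsetP FE) -> ->].
Qed.

Lemma edge_boundaryC (V : finType) (E : {set {set V}}) (U : {set V}) :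
  simple_graph E -> edge_boundary E (~: U) = edge_boundary E U.
Proof.
move=> sE; rewrite !edge_boundary_sum// setCK exchange_big.
by apply: eq_bigr => x _; apply: eq_bigr => y _; rewrite setUC.
Qed.

(** Of the [d] neighbours of a vertex of [U], at most [|U|] lie in [U]. *)
Lemma edge_boundary_small (V : finType) (E : {set {set V}}) (d : nat)
    (U : {set V}) : regular_graph d E ->
  d * #|U| <= edge_boundary E U + #|U| * #|U|.
Proof.
case/andP=> sE /forallP reg; rewrite edge_boundary_sum//.
rewrite mulnC -!sum_nat_const -big_split /=; apply: leq_sum => x _.
rewrite -(eqP (reg x)) degree_adjacent// -sum1dep_card big_mkcond.
rewrite (bigID (mem U)) /= addnC leq_add//; last first.
  by rewrite -sum1_card; apply: leq_sum => y _; case: ifP.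
rewrite [leqRHS](eq_bigl (fun y => y \notin U)) => [|y]; last by rewrite inE.
by apply: leq_sum => y _; rewrite -adjacent_simple//; case: ifP.
Qed.

Definition graph_of (V : finType) (f : rel V) : {set {set V}} :=
  [set [set p.1; p.2] | p in [set p : V * V | f p.1 p.2]].

Section GraphOf.
Variables (V : finType) (f : rel V).
Hypotheses (f_sym : symmetric f) (f_irr : irreflexive f).

Lemma simple_graph_of : simple_graph (graph_of f).
Proof.
apply/simple_graphP => _ /imsetP[[x y] + ->]; rewrite inE /= cards2.
by case: eqP => [->|//]; rewrite f_irr.
Qed.

Lemma mem_graph_of x y : ([set x; y] \in graph_of f) = f x y.
Proof.
apply/imsetP/idP => [[[a b]]|fxy]; last by exists (x, y); rewrite ?inE.
rewrite inE /= => fab xyab.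
have xy : x != y.
  have := cards2 x y; rewrite xyab cards2; case: (x =P y) => //= _.
  by case: eqP fab => [->|//]; rewrite f_irr.
have : x \in [set a; b] by rewrite -xyab set21.
rewrite !inE => /orP[] /eqP xE; rewrite xE in xy xyab *.
  by rewrite (set2_injr xy xyab).
by rewrite [RHS]setUC in xyab; rewrite (set2_injr xy xyab) f_sym.
Qed.

Lemma degree_graph_of x : degree (graph_of f) x = #|[set y | f x y]|.
Proof.
rewrite degree_adjacent ?simple_graph_of//; apply: eq_card => y.
by rewrite !inE adjacent_simple ?simple_graph_of// mem_graph_of.
Qed.

End GraphOf.

Lemma card_ord_interval (n a b : nat) : b <= n ->
  #|[set y : 'I_n | a <= y < b]| = b - a.
Proof.
move=> bn; rewrite -sum1dep_card.
rewrite (eq_bigl (fun y : 'I_n => (y < b) && (a <= y))) => [|y]; last by rewrite andbC.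
rewrite -(big_geq_mkord a n (fun y => y < b) (fun=> 1)).
by rewrite -(big_nat_widen _ _ _ predT)//= sum_nat_const_nat muln1.
Qed.

Section Construction.
Variables (n d q k : nat) (g : {ffun 'I_24 -> {perm 'I_n}}).

Let m := d.+1.
Let K := k * m.

(** The roles are read off the position: the first [K] vertices form [k] consecutive blocks of
    length [d + 1], the clumps, and all later vertices form the core. The residue modulo [m] is the
    place inside a clump; places below [2 * q] are the ports. *)
Definition core : {set 'I_n} := [set x : 'I_n | K <= x].

Definition clump (j : nat) : {set 'I_n} := [set x : 'I_n | x %/ m == j].

Hypotheses (q_gt0 : 0 < q) (q_small : 7 * q <= d) (q_big : d < 8 * q)
  (K_small : 2 * K <= n).
Hypothesis g_core : forall j, perm_on core (g j).
Hypothesis g_expands : forall S : {set 'I_n}, S \subset core ->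
  2 * #|S| <= #|core| -> #|S| <= 2 * #|(\bigcup_j g j @: S) :\: S|.

(* A clump is a complete graph on d + 1 vertices from which the matching
   r <-> 2q - 1 - r of its first 2q vertices is removed. *)
Definition clump_rel : rel 'I_n := fun x y =>
  [&& x < K, x %/ m == y %/ m, x != y & x %% m + y %% m != (2 * q).-1].

(** The shift by [K] is injective and lands in the core, within range because [2 * K <= n], so every
    port gets a core vertex of its own. The relation is oriented from clump to core; [base_rel]
    symmetrises it. *)
Definition port_rel : rel 'I_n := fun x y =>
  [&& x < K, x %% m < 2 * q & (y : nat) == x + K].

Definition core_rel : rel 'I_n := fun x y =>
  (x != y) && [exists j, (y == g j x) || (x == g j y)].

Definition base_rel : rel 'I_n := fun x y =>
  [|| clump_rel x y, port_rel x y, port_rel y x | core_rel x y].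

Lemma lt_K_block (x : 'I_n) : (x < K) = (x %/ m < k).
Proof. by rewrite ltn_divLR. Qed.

Lemma clump_rel_sym : symmetric clump_rel.
Proof.
move=> x y; rewrite /clump_rel !lt_K_block.
rewrite [y %/ m == _]eq_sym [y == x]eq_sym [y %% m + _]addnC.
by case: eqP => [->|//]; rewrite ?andbF.
Qed.

Lemma core_rel_sym : symmetric core_rel.
Proof.
move=> x y; rewrite /core_rel eq_sym; congr (_ && _).
by apply: eq_existsb => j; rewrite orbC.
Qed.

Lemma core_relP (x y : 'I_n) : core_rel x y -> K <= x /\ K <= y.
Proof.
have H (a b : 'I_n) j : a != b -> b = g j a -> K <= a /\ K <= b.
  move=> ab bE; rewrite bE in ab *; have aC : a \in core.
    by apply: contraNT ab => aC; rewrite (out_perm (g_core j) aC).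
  split; first by move: aC; rewrite inE.
  by have := perm_closed a (g_core j); rewrite aC inE.
case/andP=> xy /existsP[j /orP[] /eqP E]; first exact: H E.
by have [] : K <= y /\ K <= x by apply: H E; rewrite eq_sym.
Qed.

Lemma base_rel_sym : symmetric base_rel.
Proof.
move=> x y; rewrite /base_rel clump_rel_sym core_rel_sym; congr (_ || _).
by rewrite orbCA.
Qed.

Lemma base_rel_irr : irreflexive base_rel.
Proof.
move=> x; have noport : ~ port_rel x x.
  case/and3P=> xK _ /eqP; move: xK; clear; lia.
by apply/negP => /or4P[/and4P[_ _ /eqP]||| /andP[/eqP]].
Qed.

Lemma card_clump j : j < k -> #|clump j| = m.
Proof.
move=> jk; have jmn : j.+1 * m <= n.
  apply: leq_trans K_small; apply: (@leq_trans K); first by rewrite leq_mul2r jk orbT.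
  by rewrite mul2n -addnn leq_addr.
have -> : clump j = [set x : 'I_n | j * m <= x < j.+1 * m].
  by apply/setP => x; rewrite !inE eqn_leq -ltnS ltn_divLR// leq_divRL// andbC.
by rewrite card_ord_interval// mulSn addnK.
Qed.

Lemma clump_mod j (x : 'I_n) : x \in clump j -> (x : nat) = j * m + x %% m.
Proof. by rewrite inE => /eqP <-; rewrite -divn_eq. Qed.

Lemma card_clump_ports j : j < k ->
  #|[set x in clump j | x %% m < 2 * q]| = 2 * q.
Proof.
move=> jk; have jmn : j * m + 2 * q <= n.
  apply: leq_trans K_small; apply: (@leq_trans (j.+1 * m)).
    rewrite (mulSn j m) addnC leq_add2r /m; move: q_small; clear; lia.
  apply: (@leq_trans K); first by rewrite leq_mul2r jk orbT.
  by rewrite mul2n -addnn leq_addr.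
have -> : [set x in clump j | x %% m < 2 * q] =
    [set x : 'I_n | j * m <= x < j * m + 2 * q].
  apply/setP => x; rewrite inE [RHS]inE; apply/andP/andP => [[xj xq]|[lo hi]].
    by rewrite (clump_mod xj) leq_addr ltn_add2l.
  have xj : x \in clump j.
    rewrite inE eqn_leq -ltnS ltn_divLR// leq_divRL// lo andbT.
    rewrite (leq_trans hi)// (mulSn j m) addnC leq_add2r /m; move: q_small; clear; lia.
  by split=> //; move: hi; rewrite {1}(clump_mod xj) ltn_add2l.
by rewrite card_ord_interval// addKn.
Qed.

Lemma card_core : #|core| = n - K.
Proof.
rewrite -(@card_ord_interval n K n)//; apply: eq_card => x.
by rewrite !inE ltn_ord andbT.
Qed.

Lemma card_partner_le1 j (x : 'I_n) :
  #|[set y in clump j | x %% m + y %% m == (2 * q).-1]| <= 1.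
Proof.
apply/card_le1_eqP => y z; rewrite inE => /andP[yj /eqP yx].
rewrite inE => /andP[zj /eqP zx].
apply: val_inj; rewrite /= (clump_mod yj) (clump_mod zj); congr (_ + _).
by apply/eqP; rewrite -(eqn_add2l (x %% m)) yx zx.
Qed.

Lemma card_partner j (x : 'I_n) : j < k ->
  #|[set y in clump j | x %% m + y %% m == (2 * q).-1]| = (x %% m < 2 * q).
Proof.
move=> jk; case: ltnP => xq; last first.
  apply/eqP; rewrite cards_eq0; apply/eqP/setP => y; rewrite !inE.
  apply/negP => /andP[_ /eqP]; move: xq q_gt0; clear; lia.
apply/eqP; rewrite eqn_leq card_partner_le1 card_gt0; apply/set0Pn.
have rm : (2 * q).-1 - x %% m < m by rewrite /m; move: q_small; clear; lia.
have yn : j * m + ((2 * q).-1 - x %% m) < n.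
  apply: leq_trans K_small; apply: (@leq_trans (j.+1 * m)).
    by rewrite (mulSn j m) addnC ltn_add2r.
  apply: (@leq_trans K); first by rewrite leq_mul2r jk orbT.
  by rewrite mul2n -addnn leq_addr.
exists (Ordinal yn); rewrite !inE /= divnMDl// divn_small// addn0 eqxx /=.
rewrite modnMDl (modn_small rm); move: xq q_gt0; clear; lia.
Qed.

Lemma card_ports (x : 'I_n) : x < K ->
  #|[set y | port_rel x y]| = (x %% m < 2 * q).
Proof.
move=> xK; rewrite /port_rel xK /=; case: ltnP => xq /=; last first.
  by apply/eqP; rewrite cards_eq0; apply/eqP/setP => y; rewrite !inE.
have xKn : x + K < n by move: xK K_small; clear; lia.
by rewrite -(cards1 (Ordinal xKn)); apply: eq_card => y; rewrite !inE.
Qed.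

Lemma card_clump_nbrs (x : 'I_n) : x < K ->
  #|[set y | clump_rel x y]| + (x %% m < 2 * q) = d.
Proof.
move=> xK; have jk : x %/ m < k by rewrite -lt_K_block.
set P := [set y in clump (x %/ m) | x %% m + y %% m == (2 * q).-1].
have xc : x \in clump (x %/ m) by rewrite inE.
have PC : P \subset clump (x %/ m) :\ x.
  apply/subsetP => y; rewrite inE => /andP[yj /eqP xy]; rewrite in_setD1 yj andbT.
  (* The matched residues sum to [2q - 1], which is odd, so no vertex is its own partner. *)
  apply/eqP => yx; move: xy q_gt0; rewrite yx; clear; lia.
have -> : [set y | clump_rel x y] = (clump (x %/ m) :\ x) :\: P.
  apply/setP => y; rewrite !inE /clump_rel xK /= negb_and.
  rewrite (eq_sym y x) (eq_sym (y %/ m) (x %/ m)).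
  by case: (x %/ m == y %/ m); case: (x == y); case: (_ == _.-1).
rewrite -(card_partner x jk) -/P cardsDS// subnK; last exact: subset_leq_card.
by have := cardsD1 x (clump (x %/ m)); rewrite xc card_clump// /m => -[].
Qed.

Lemma base_rel_clump (x y : 'I_n) : x < K ->
  base_rel x y = clump_rel x y || port_rel x y.
Proof.
move=> xK; rewrite /base_rel; congr (_ || _).
have -> : port_rel y x = false.
  by apply/negP => /and3P[_ _ /eqP xE]; move: xK; rewrite xE ltnNge leq_addl.
have -> : core_rel x y = false.
  by apply/negP => /core_relP[]; rewrite leqNgt xK.
by rewrite !orbF.
Qed.

Lemma clump_rel_lt (x y : 'I_n) : clump_rel x y -> x < K /\ y < K.
Proof.
by case/and4P=> xK /eqP xy _ _; split=> //; move: xK; rewrite !lt_K_block xy.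
Qed.

(** The edge lost by a port to the matching is restored by its core edge. Clump vertices are
    therefore saturated, and the completion can add edges only inside the core. *)
Lemma degree_base_clump (x : 'I_n) : x < K -> degree (graph_of base_rel) x = d.
Proof.
move=> xK; rewrite (degree_graph_of base_rel_sym base_rel_irr).
have -> : [set y | base_rel x y] =
    [set y | clump_rel x y] :|: [set y | port_rel x y].
  by apply/setP => y; rewrite !inE base_rel_clump.
rewrite cardsU disjoint_setI0 ?cards0 ?subn0.
  by rewrite card_ports// card_clump_nbrs.
rewrite -setI_eq0; apply/eqP/setP => y; rewrite !inE.
apply/negP => /andP[/clump_rel_lt[_ yK] /and3P[_ _ /eqP yE]].
by move: yK; rewrite yE ltnNge leq_addl.
Qed.

(** 49 = 1 + 24 + 24: one port, and the images and preimages under the 24 permutations. *)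
Lemma degree_base_core (x : 'I_n) : K <= x ->
  degree (graph_of base_rel) x <= 49.
Proof.
move=> xK; rewrite (degree_graph_of base_rel_sym base_rel_irr).
pose A := [set y | port_rel y x].
pose B := [set g j x | j in 'I_24] :|: [set ((g j)^-1)%g x | j in 'I_24].
apply: (@leq_trans #|A :|: B|).
  apply/subset_leq_card/subsetP => y; rewrite inE in_setU /base_rel.
  case/or4P=> [/clump_rel_lt[]|/and3P[]|yx|].
  - by rewrite ltnNge xK.
  - by rewrite ltnNge xK.
  - by rewrite inE yx.
  case/andP=> _ /existsP[j /orP[] /eqP E]; apply/orP; right; rewrite in_setU.
    by rewrite E imset_f.
  by apply/orP; right; apply/imsetP; exists j; rewrite // E permK.
apply: leq_trans (leq_card_setU _ _) _; rewrite -[49]/(1 + 48) leq_add//.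
  apply/card_le1_eqP => y z; rewrite !inE => /and3P[_ _ /eqP yx] /and3P[_ _ /eqP zx].
  by apply: val_inj; apply/eqP; rewrite /= -(eqn_add2r K) -yx -zx.
apply: leq_trans (leq_card_setU _ _) _; rewrite -[48]/(24 + 24) leq_add//.
  by rewrite (leq_trans (leq_imset_card _ _))// cardT size_enum_ord.
by rewrite (leq_trans (leq_imset_card _ _))// cardT size_enum_ord.
Qed.

(** * Edge expansion of the base graph *)

Lemma sum_clumps (W : {set 'I_n}) (F : 'I_n -> nat) :
  \sum_(x in W | x < K) F x = \sum_(j < k) \sum_(x in W :&: clump j) F x.
Proof.
rewrite (exchange_big_dep (fun x : 'I_n => (x \in W) && (x < K))) /=; last first.
  by move=> j x _; rewrite !inE lt_K_block => /andP[-> /eqP ->] /=.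
apply: eq_bigr => x /andP[xW xK].
have jk : x %/ m < k by rewrite -lt_K_block.
rewrite (big_pred1 (Ordinal jk))// => j.
by rewrite !inE xW /= -(inj_eq val_inj) eq_sym.
Qed.

(** The removed matching costs each vertex of [S] at most one neighbour in [T]. *)
Lemma clump_rel_sum_ge j (S T : {set 'I_n}) : j < k ->
  S \subset clump j -> T \subset clump j -> [disjoint S & T] ->
  #|S| * (#|T| - 1) <= \sum_(x in S) \sum_(y in T) clump_rel x y.
Proof.
move=> jk Sj Tj dST; rewrite -sum_nat_const; apply: leq_sum => x xS.
have := subsetP Sj _ xS; rewrite inE => /eqP xj.
have xK : x < K by rewrite lt_K_block xj.
set P := [set y in clump j | x %% m + y %% m == (2 * q).-1].
apply: (@leq_trans #|T :\: P|).
  rewrite cardsD leq_sub2l// (leq_trans _ (card_partner_le1 j x))//.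
  exact/subset_leq_card/subsetIr.
rewrite -sum1_card [leqLHS]big_mkcond [leqRHS]big_mkcond; apply: leq_sum => y _.
rewrite in_setD; case yT: (y \in T); rewrite ?andbF//= andbT.
have yj := subsetP Tj _ yT; rewrite inE yj /=; case: ifP => // xy.
move: yj; rewrite inE /clump_rel xK xj => /eqP -> /=; rewrite eqxx xy andbT /=.
by case: eqP => // xy'; move: (disjointFr dST xS); rewrite xy' yT.
Qed.

(** A clump inside [W] is paid for by its [2q] ports, as [d + 1 <= 8q]. If one vertex [t] is
    missing, nearly all others are joined to it; if at least two are missing, each vertex of the
    clump in [W] has an edge to a missing one. *)
Lemma clump_expansion (W : {set 'I_n}) j : j < k ->
  #|W :&: clump j| <=
    10 * (\sum_(x in W :&: clump j) \sum_(y in ~: W) clump_rel x y) +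
    4 * #|[set x in W :&: clump j | x %% m < 2 * q]|.
Proof.
move=> jk; set A := W :&: clump j; set T := clump j :\: W.
set c := \sum_(x in A) _; set e := #|[set x in A | _]|.
have Aj : A \subset clump j by exact: subsetIr.
have Tj : T \subset clump j by exact: subsetDl.
have dAT : [disjoint A & T].
  by rewrite -setI_eq0; apply/eqP/setP => x; rewrite !inE; case: (x \in W); rewrite ?andbF.
have cardAT : #|A| + #|T| = m by rewrite -(card_clump jk) -(cardsID W (clump j)) setIC.
have c_ge : \sum_(x in A) \sum_(y in T) clump_rel x y <= c.
  apply: leq_sum => x _; rewrite big_mkcond [leqRHS]big_mkcond; apply: leq_sum => y _.
  by rewrite !inE; case: (y \in W) => //=; case: (_ == j).
have c1 := leq_trans (clump_rel_sum_ge jk Aj Tj dAT) c_ge.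
have c2 : #|T| * (#|A| - 1) <= c.
  apply: leq_trans c_ge; rewrite exchange_big /=.
  rewrite disjoint_sym in dAT.
  apply: leq_trans (clump_rel_sum_ge jk Tj Aj dAT) _.
  by apply: leq_sum => y _; apply: leq_sum => x _; rewrite clump_rel_sym.
have e_full : #|T| = 0 -> e = 2 * q.
  move=> T0; rewrite -(card_clump_ports jk); apply: eq_card => x; rewrite !inE.
  case xj: (x %/ m == j); rewrite ?andbF//= andbT.
  have : x \notin T by rewrite (cards0_eq T0) inE.
  by rewrite !inE xj andbT negbK => ->.
have arith (a t c' e' : nat) : a + t = d.+1 -> a * (t - 1) <= c' ->
    t * (a - 1) <= c' -> (t = 0 -> e' = 2 * q) -> a <= 10 * c' + 4 * e'.
  by move: q_big q_gt0 q_small; clear; case: t => [|[|t]]; nia.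
exact: arith cardAT c1 c2 e_full.
Qed.

(** The core partner of a port in [W] either lies outside [W], giving a boundary edge, or belongs to
    [W :&: core]; distinct ports have distinct partners. *)
Lemma port_expansion (W : {set 'I_n}) :
  \sum_(x in W | x < K) (x %% m < 2 * q) <=
  \sum_(x in W) \sum_(y in ~: W) port_rel x y + #|W :&: core|.
Proof.
have -> : \sum_(x in W | x < K) (x %% m < 2 * q) =
    \sum_(x in W) \sum_y port_rel x y.
  rewrite big_mkcondr; apply: eq_bigr => x _.
  have -> : \sum_y port_rel x y = #|[set y | port_rel x y]|.
    by rewrite -sum1dep_card [RHS]big_mkcond; apply: eq_bigr => y _; case: port_rel.
  case: ifP => xK; first by rewrite card_ports.
  apply/esym/eqP; rewrite cards_eq0; apply/eqP/setP => y.
  by rewrite !inE /port_rel xK.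
have -> : \sum_(x in W) \sum_y port_rel x y =
    \sum_(x in W) \sum_(y in ~: W) port_rel x y +
    \sum_(x in W) \sum_(y in W) port_rel x y.
  rewrite -big_split /=; apply: eq_bigr => x _.
  rewrite (bigID (mem W)) /= addnC; congr (_ + _).
  by apply: eq_bigl => y; rewrite inE.
rewrite leq_add2l exchange_big -sum1_card [leqRHS]big_mkcond [leqLHS]big_mkcond /=.
apply: leq_sum => y _; rewrite in_setI; case: (y \in W) => //=.
rewrite [y \in core]inE; case: (leqP K y) => yK.
  apply: (@leq_trans #|[set x | port_rel x y]|).
    rewrite -sum1dep_card [leqLHS]big_mkcond [leqRHS]big_mkcond; apply: leq_sum => x _.
    by case: ifP => // _; case: port_rel.
  apply/card_le1_eqP => x z; rewrite !inE => /and3P[_ _ /eqP yx] /and3P[_ _ /eqP zx].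
  by apply: val_inj; apply/eqP; rewrite /= -(eqn_add2r K) -yx -zx.
rewrite leqn0 sum_nat_eq0; apply/forall_inP => x _; rewrite eqb0.
by apply/negP => /and3P[_ _ /eqP yE]; move: yK; rewrite yE ltnNge leq_addl.
Qed.

(** Every vertex gained by applying the permutations to [W :&: core] lies outside [W] and is the end
    of a boundary edge. *)
Lemma core_expansion (W : {set 'I_n}) : 2 * #|W :&: core| <= #|core| ->
  #|W :&: core| <= 2 * \sum_(x in W) \sum_(y in ~: W) core_rel x y.
Proof.
move=> small; apply: leq_trans (g_expands (subsetIr _ _) small) _.
rewrite leq_mul2l /= exchange_big -sum1_card.
rewrite [leqLHS]big_mkcond [leqRHS]big_mkcond /=.
apply: leq_sum => y _; case: ifP => // /setDP[/bigcupP[j _ /imsetP[x xS yE]] yS].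
have /setIP[xW xC] := xS.
have yC : y \in core by rewrite yE (perm_closed _ (g_core j)).
have yW : y \in ~: W by move: yS; rewrite !inE in yC *; rewrite yC andbT.
rewrite yW (bigD1 x)//= (leq_trans _ (leq_addr _ _))// lt0b /core_rel.
apply/andP; split; last by apply/existsP; exists j; rewrite yE eqxx.
by apply: contraNneq yS => <-.
Qed.

Lemma base_rel_ge (x y : 'I_n) :
  clump_rel x y + port_rel x y + core_rel x y <= base_rel x y.
Proof.
have [xK|xK] := ltnP x K.
  rewrite base_rel_clump//.
  have -> : core_rel x y = false by apply/negP => /core_relP[]; rewrite leqNgt xK.
  rewrite addn0; case cxy: (clump_rel x y); case pxy: (port_rel x y) => //.
  have [_] := clump_rel_lt cxy; case/and3P: pxy => _ _ /eqP ->.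
  by rewrite ltnNge leq_addl.
have -> : clump_rel x y = false by rewrite /clump_rel ltnNge xK.
have -> : port_rel x y = false by rewrite /port_rel ltnNge xK.
by rewrite /base_rel; case: core_rel; rewrite ?orbT.
Qed.

(** With [cl], [po], [co] the boundary edges of the three kinds, [p] the ports in [W] and
    [wc = |W :&: core|], the three expansion bounds give [|W| <= 10 cl + 4 p + wc <= 10 cl + 4 po +
    5 wc <= 10 (cl + po + co)]. This is the source of the constant 10. *)
Lemma base_expansion (W : {set 'I_n}) : 2 * #|W :&: core| <= #|core| ->
  #|W| <= 10 * edge_boundary (graph_of base_rel) W.
Proof.
move=> small; set Scl := \sum_(x in W | x < K) \sum_(y in ~: W) clump_rel x y.
set Spo := \sum_(x in W) \sum_(y in ~: W) port_rel x y.
set Sco := \sum_(x in W) \sum_(y in ~: W) core_rel x y.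
have total : Scl + Spo + Sco <= edge_boundary (graph_of base_rel) W.
  rewrite edge_boundary_sum; last exact: simple_graph_of base_rel_irr.
  apply: (@leq_trans (\sum_(x in W) \sum_(y in ~: W) clump_rel x y + Spo + Sco)).
    rewrite !leq_add2r /Scl big_mkcondr; apply: leq_sum => x _.
    by case: ifP.
  rewrite -!big_split /=; apply: leq_sum => x _.
  rewrite -!big_split /=; apply: leq_sum => y _.
  by rewrite (mem_graph_of base_rel_sym base_rel_irr) base_rel_ge.
set B := \sum_(x in W | x < K) (x %% m < 2 * q).
have clumps : #|W :\: core| <= 10 * Scl + 4 * B.
  have -> : #|W :\: core| = \sum_(x in W | x < K) 1.
    by rewrite sum1dep_card; apply: eq_card => x; rewrite !inE -ltnNge andbC.
  rewrite /Scl /B !sum_clumps !big_distrr -big_split /=; apply: leq_sum => j _.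
  rewrite sum1_card; apply: leq_trans (clump_expansion W (ltn_ord j)) _.
  rewrite leq_add2l leq_mul2l /= -sum1_card [leqLHS]big_mkcond [leqRHS]big_mkcond.
  apply: leq_sum => x _; rewrite !inE.
  by case: (x \in W) => //=; case: (_ == _) => //=; case: (_ < _).
have arith (wc w cl po co p e : nat) : w <= 10 * cl + 4 * p ->
    p <= po + wc -> wc <= 2 * co -> cl + po + co <= e -> wc + w <= 10 * e.
  by clear; lia.
rewrite -(cardsID core W).
exact: arith clumps (port_expansion W) (core_expansion small) total.
Qed.

(** * Transfer to the completed regular graph *)

Section Completed.
Variable E : {set {set 'I_n}}.
Hypotheses (base_E : graph_of base_rel \subset E) (regE : regular_graph d E).

(** A clump vertex already has degree [d] in the base graph, so its star cannot grow. *)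
Lemma completed_clump (x y : 'I_n) : x < K -> ([set x; y] \in E) = base_rel x y.
Proof.
move=> xK; rewrite -(mem_graph_of base_rel_sym base_rel_irr).
have /andP[_ /forallP /(_ x) /eqP dE] := regE.
have : [set e in graph_of base_rel | x \in e] == [set e in E | x \in e].
  rewrite eqEcard -/(degree E x) dE -(degree_base_clump xK) leqnn andbT.
  by apply/subsetP => e; rewrite !inE => /andP[/(subsetP base_E) -> ->].
by move=> /eqP/setP/(_ [set x; y]); rewrite !inE eqxx /= !andbT.
Qed.

Lemma card_cut_clump j : j < k -> #|cut E (clump j)| = 2 * q.
Proof.
move=> jk; have /andP[sE _] := regE.
rewrite -[LHS]/(edge_boundary E (clump j)) edge_boundary_sum//.
rewrite -(card_clump_ports jk) -sum1dep_card big_mkcondr.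
apply: eq_bigr => x xj.
have xK : x < K by move: xj; rewrite inE lt_K_block => /eqP ->.
have -> : (if x %% m < 2 * q then 1 else 0) = (x %% m < 2 * q) by case: (_ < _).
rewrite -(card_ports xK) -sum1dep_card big_mkcond [RHS]big_mkcond.
apply: eq_bigr => y _; rewrite completed_clump// base_rel_clump// in_setC.
move: xj; rewrite inE => /eqP xj; rewrite inE.
case yj: (y %/ m == j) => /=; last first.
  have -> : clump_rel x y = false by rewrite /clump_rel xj eq_sym yj andbF.
  by case: port_rel.
have yK : y < K by rewrite lt_K_block (eqP yj).
case: ifP => // /and3P[_ _ /eqP yE]; by move: yK; rewrite yE ltnNge leq_addl.
Qed.

Lemma disjoint_cut_clump i j : i < k -> j < k -> i != j ->
  [disjoint cut E (clump i) & cut E (clump j)].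
Proof.
move=> ik jk ij; have /andP[sE _] := regE.
rewrite -setI_eq0; apply/eqP/setP => e; rewrite !inE.
apply/negP => /andP[/andP[eE ci] /andP[_ cj]].
have /card_gt0P[x /setIP[xe xi]] : 0 < #|e :&: clump i| by rewrite (eqP ci).
have /card_gt0P[z /setIP[ze zj]] : 0 < #|e :&: clump j| by rewrite (eqP cj).
have [y xy eE'] := edge_endpoints sE eE xe.
move: (xi) (zj); rewrite !inE => /eqP xi' /eqP zj'.
have xK : x < K by rewrite lt_K_block xi'.
have zK : z < K by rewrite lt_K_block zj'.
have zy : z = y.
  move: ze; rewrite eE' !inE => /orP[/eqP zx|/eqP//].
  by move: ij; rewrite -xi' -zj' zx eqxx.
move: eE; rewrite eE' -zy completed_clump// base_rel_clump//.
case/orP=> [/and4P[_ /eqP xz _ _]|/and3P[_ _ /eqP zE]].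
  by move: ij; rewrite -xi' -zj' xz eqxx.
by move: zK; rewrite zE ltnNge leq_addl.
Qed.

(** If [U] contains more than half of the core, its complement contains less than half. The
    complement has the same boundary and is at least as large as [U], so its bound suffices. *)
Lemma completed_expansion (U : {set 'I_n}) : 2 * #|U| <= n ->
  #|U| <= 10 * edge_boundary E U.
Proof.
move=> Un; have /andP[sE _] := regE.
have half (W : {set 'I_n}) : 2 * #|W :&: core| <= #|core| ->
    #|W| <= 10 * edge_boundary E W.
  move=> /base_expansion /leq_trans; apply.
  by rewrite leq_mul2l edge_boundary_sub.
have [/half//|big] := leqP (2 * #|U :&: core|) #|core|.
rewrite -edge_boundaryC//; apply: leq_trans (half (~: U) _).
  by have := cardsC U; rewrite card_ord; move: Un; clear; lia.
move: big; rewrite -(cardsID U core) [core :&: U]setIC.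
by rewrite setDE [core :&: ~: U]setIC; clear; lia.
Qed.

End Completed.

End Construction.

Lemma clump_graph_exists (n d q k : nat) :
  56 <= d -> d ^ 2 <= n -> ~~ odd (n * d) -> 7 * q <= d -> d < 8 * q ->
  2 * (k * d.+1) <= n ->
  exists E : {set {set 'I_n}},
  [/\ regular_graph d E,
      forall U : {set 'I_n}, 2 * #|U| <= n -> #|U| <= 10 * edge_boundary E U,
      forall j, j < k -> #|clump n d j| = d.+1,
      forall j, j < k -> #|cut E (clump n d j)| = 2 * q &
      forall i j, i < k -> j < k -> i != j ->
        [disjoint cut E (clump n d i) & cut E (clump n d j)]].
Proof.
move=> d_big dn evn q_small q_big Kn.
have q_gt0 : 0 < q by case: q q_big {q_small} => //; rewrite muln0.
have [g [g_core g_exp]] := expander_perms (core n d k).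
have irr : irreflexive (base_rel d q k g) by exact: base_rel_irr.
pose F := graph_of (base_rel d q k g).
have deg_clump (x : 'I_n) : x < k * d.+1 -> degree F x = d.
  exact: degree_base_clump.
have deg_core (x : 'I_n) : k * d.+1 <= x -> degree F x <= 49.
  exact: degree_base_core.
have [E FE regE] : exists2 E : {set {set 'I_n}}, F \subset E & regular_graph d E.
  apply: regular_completion.
  - exact: simple_graph_of irr.
  - move=> x; case: (ltnP x (k * d.+1)) => xK; first by rewrite deg_clump.
    by rewrite (leq_trans (deg_core _ xK))// (leq_trans _ d_big).
  - by rewrite card_ord.
  (* The core has at least [n / 2] vertices, each lacking at least [56 - 49 = 7] edges, so the
     deficiency is at least [7 n / 2], which exceeds [3 d^2]. *)
  - apply: (@leq_trans (\sum_(x in core n d k) (d - 49))).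
      rewrite sum_nat_const card_core.
      move: dn Kn d_big; move: (k * d.+1) => K; clear; nia.
    rewrite big_mkcond; apply: leq_sum => x _; case: ifP => //.
    by rewrite inE => xK; rewrite leq_sub2l ?deg_core.
exists E; split=> //.
- exact: (completed_expansion q_gt0 q_small q_big Kn g_core g_exp FE regE).
- exact: (card_clump Kn).
- exact: (card_cut_clump q_gt0 q_small Kn g_core FE regE).
- exact: (disjoint_cut_clump q_gt0 q_small Kn g_core FE regE).
Qed.

(** * Probability estimates *)

From mathcomp Require Import all_classical all_reals all_analysis.
Import numFieldNormedType.Exports.

Local Open Scope classical_set_scope.
Local Open Scope ring_scope.

Lemma bernoulli_sub (R : realFieldType) (x : R) (b : nat) :
  0 <= x <= 1 -> 1 - b%:R * x <= (1 - x) ^+ b.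
Proof.
move=> /andP[x0 x1]; elim: b => [|b IHb]; first by rewrite expr0 mul0r subr0.
rewrite exprS; have h : 0 <= 1 - x by lra.
apply: le_trans (ler_wpM2l h IHb); rewrite -natr1.
have : 0 <= (b%:R : R) * (x * x) by rewrite !mulr_ge0.
lra.
Qed.

Lemma ffact_ratio_ge (R : realFieldType) (L M b : nat) : (b <= L <= M)%N ->
  ((L - b)%:R / M%:R) ^+ b <= (L ^_ b)%:R / (M ^_ b)%:R :> R.
Proof.
move=> /andP[bL LM]; have bM := leq_trans bL LM.
have [->|b0] := posnP b; first by rewrite expr0 !ffactn0 divr1.
have M0 : (0 < M)%N by apply: leq_trans bM.
rewrite ler_pdivlMr ?ltr0n ?ffact_gt0// expr_div_n mulrAC ler_pdivrMr; last first.
  by rewrite exprn_gt0// ltr0n.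
rewrite -!natrX -!natrM ler_nat leq_mul//.
  have : forall c, (c <= b)%N -> ((L - b) ^ c <= L ^_ c)%N.
    elim=> [|c IHc] cb; first by rewrite ffactn0.
    by rewrite ffactnSr expnSr leq_mul ?IHc ?(ltnW cb)// leq_sub2l// ltnW.
  exact.
have : forall c, (M ^_ c <= M ^ c)%N.
  elim=> [|c IHc]; first by rewrite ffactn0.
  by rewrite ffactnSr expnSr leq_mul// leq_subr.
exact.
Qed.

Lemma ffact_ratio_pow_le (R : realFieldType) (L M d : nat) : (L <= M)%N ->
  (d <= M)%N -> (0 < M)%N ->
  (L ^_ d)%:R / (M ^_ d)%:R <= (L%:R / M%:R) ^+ d :> R.
Proof.
move=> LM dM M0; rewrite ler_pdivrMr ?ltr0n ?ffact_gt0// expr_div_n mulrAC.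
rewrite ler_pdivlMr ?exprn_gt0 ?ltr0n// -!natrX -!natrM ler_nat.
exact: ffact_ratio_le.
Qed.

Section Estimates.
Variables (R : realType) (n d q k M : nat).
Hypotheses (d_big : (56 <= d)%N) (dn : (d ^ 2 <= n)%N) (q7 : (7 * q <= d)%N)
  (M2 : (2 * M = n * d)%N) (k_big : (n < 2 * d.+1 * k.+1)%N).

(* Roughly the fraction of edges still missing when the expected number of
   isolated vertices has dropped to n^(-1/2). *)
Let r : R := n%:R `^ (- (3 / (2 * d%:R))).
Let L := Num.truncn (M%:R * r).

Let n_gt0 : (0 < n)%N.
Proof. by rewrite (leq_trans _ dn)// expn_gt0 (leq_trans _ d_big). Qed.

Let nr1 : 1 <= (n%:R : R).
Proof. by rewrite ler1n. Qed.

Let d_le_sqrt : (d%:R : R) <= n%:R `^ 2^-1.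
Proof.
rewrite powR12_sqrt// -[leLHS]ger0_norm// -sqrtr_sqr.
by rewrite ler_sqrt// -natrX ler_nat.
Qed.

Let dr : 56 <= (d%:R : R).
Proof. by rewrite (ler_nat R 56 d). Qed.

Let r_gt0 : 0 < r.
Proof. by rewrite powR_gt0// ltr0n. Qed.

Let r_le1 : r <= 1.
Proof.
by rewrite /r -[leRHS](powRr0 (n%:R : R)) ler_powR// oppr_le0 divr_ge0// mulr_ge0.
Qed.

Let r_pow (c : nat) : r ^+ c = n%:R `^ (- (3 / (2 * d%:R)) * c%:R).
Proof. by rewrite powRrM powR_mulrn// ltW. Qed.

(** [n * r >= n^(1/2) >= d] because [3 / (2d) <= 1/2]. With order [d^2] edges missing, the rounding
    in [L] and the drawing without replacement cost only a constant factor. *)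
Let Mr_big : d%:R ^+ 2 / 2 <= M%:R * r.
Proof.
have MR : (M%:R : R) = n%:R * d%:R / 2.
  by rewrite -natrM -M2 natrM mulrC mulKf.
have : d%:R <= n%:R * r.
  apply: le_trans d_le_sqrt _.
  rewrite /r -{2}(powRr1 (ler0n _ n)) -powRD ?pnatr_eq0 -?lt0n ?n_gt0 ?implybT//.
  rewrite ler_powR//.
  have : 3 / (2 * d%:R) <= 2^-1 :> R; last by lra.
  by rewrite ler_pdivrMr; have := dr; lra.
move=> h; have := ler_wpM2l (ler0n R d) h; rewrite MR expr2; lra.
Qed.

Lemma truncated_edges : [/\ (L <= M)%N, (2 * q <= L)%N & (d <= M)%N].
Proof.
have Mr0 : 0 <= M%:R * r by rewrite mulr_ge0// ltW.
have /andP[L1 L2] := truncn_itv Mr0; split.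
- rewrite -(ler_nat R) (le_trans L1)// -[leRHS]mulr1 ler_wpM2l//.
- rewrite -ltnS -(ltr_nat R); apply: le_lt_trans L2; apply: le_trans Mr_big.
  apply: (@le_trans _ _ d%:R); first by rewrite ler_nat; move: q7; clear; lia.
  by have := dr; have := ler_wpM2l (ler0n R d) dr; rewrite expr2; lra.
- by move: M2 dn d_big; clear; nia.
Qed.

Lemma isolated_vertices_le :
  n%:R * ((L ^_ d)%:R / (M ^_ d)%:R) <= n%:R `^ (- 14^-1) :> R.
Proof.
have [LM _ dM] := truncated_edges.
have M0 : (0 < M)%N by apply: leq_trans dM; apply: leq_trans d_big.
have Mr0 : 0 <= M%:R * r by rewrite mulr_ge0// ltW.
have /andP[L1 _] := truncn_itv Mr0.
apply: (@le_trans _ _ (n%:R * r ^+ d)).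
  rewrite ler_wpM2l//; apply: le_trans (ffact_ratio_pow_le R LM dM M0) _.
  apply: lerXn2r; rewrite ?nnegrE ?divr_ge0 ?(ltW r_gt0)//.
  by rewrite ler_pdivrMr ?ltr0n// mulrC.
rewrite r_pow -{1}(powRr1 (ler0n _ n)) -powRD ?pnatr_eq0 -?lt0n ?n_gt0 ?implybT//.
rewrite ler_powR//.
have -> : - (3 / (2 * d%:R)) * d%:R = - (3 / 2) :> R by field; have := dr; lra.
lra.
Qed.

(** The number of clumps is at least [n^(1/2) / 8] and each is cut off with probability at least
    [n^(-3/7) / 2]; the expected number of clumps cut off is thus at least [n^(1/14) / 16]. *)
Lemma isolated_clumps_ge :
  (k%:R * ((L ^_ (2 * q))%:R / (M ^_ (2 * q))%:R))^-1
    <= 16 * n%:R `^ (- 14^-1) :> R.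
Proof.
have [LM bL dM] := truncated_edges; set b := (2 * q)%N in bL *.
have M0 : (0 < M)%N by apply: leq_trans dM; apply: leq_trans d_big.
have M0r : 0 < (M%:R : R) by rewrite ltr0n.
have Mr0 : 0 < M%:R * r by rewrite mulr_gt0.
have /andP[_ L2] := truncn_itv (ltW Mr0).
(* [x] is the relative loss in replacing [M * r] by [L - b]: at most 1 from truncation and [b] from
   the falling factorial. Since [b * x <= 1/2], Bernoulli's inequality bounds the total loss by a
   factor 2. *)
pose x : R := b.+1%:R / (M%:R * r).
have bR : 7 * (b%:R : R) <= 2 * d%:R.
  by rewrite -!natrM ler_nat /b; move: q7; clear; lia.
have b0 : 0 <= (b%:R : R) by [].
have bx : b%:R * x <= 2^-1.
  rewrite /x mulrA ler_pdivrMr//; apply: le_trans (ler_wpM2l _ Mr_big) => //.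
  rewrite -natr1.
  have : (7 * b%:R) * (2 * b%:R + 2) <= (2 * d%:R) * d%:R :> R.
    by apply: ler_pM; have := dr; lra.
  have : 0 <= d%:R * d%:R :> R by rewrite mulr_ge0.
  rewrite expr2; lra.
have x01 : 0 <= x <= 1.
  rewrite divr_ge0 ?(ltW Mr0)//=; rewrite ler_pdivrMr// mul1r.
  apply: le_trans Mr_big; rewrite -natr1.
  have := dr; have := ler_wpM2l (ler0n R d) dr; rewrite expr2; lra.
have base : r * (1 - x) <= (L - b)%:R / M%:R.
  rewrite ler_pdivlMr// natrB// mulrBr mulr1 mulrBl.
  have -> : r * x * M%:R = b%:R + 1 by rewrite /x -natr1; field; rewrite !gt_eqF.
  by move: L2; rewrite -/L -natr1 mulrC; lra.
have ratio : n%:R `^ (- (3 / 7)) / 2 <= (L ^_ b)%:R / (M ^_ b)%:R :> R.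
  have bLM : (b <= L <= M)%N by rewrite bL LM.
  apply: le_trans (ffact_ratio_ge R bLM).
  apply: (@le_trans _ _ ((r * (1 - x)) ^+ b)); last first.
    apply: lerXn2r; rewrite ?nnegrE ?divr_ge0 ?mulr_ge0 ?(ltW r_gt0)//.
    by move: x01; lra.
  rewrite exprMn r_pow ler_pM ?powR_ge0 ?invr_ge0//.
    rewrite ler_powR// mulNr lerN2 mulrAC ler_pdivrMr; last by have := dr; lra.
    by have := bR; lra.
  by apply: le_trans (bernoulli_sub b x01); lra.
(* With [s = n^(1/2) >= d], the hypothesis on [k] gives [s^2 <= 2 (s + 1) (k + 1)]. If [8 k < s],
   this yields [4 s^2 < (s + 1) (s + 8)], which is false for [s >= 56]. *)
have kR : n%:R `^ 2^-1 <= 8 * k%:R :> R.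
  set s := n%:R `^ 2^-1.
  have sE : s * s = n%:R.
    rewrite -powRD; last by rewrite pnatr_eq0 -lt0n n_gt0 implybT.
    by rewrite [X in _ `^ X](_ : _ = 1) ?powRr1//; lra.
  have : n%:R <= 2 * (d%:R + 1) * (k%:R + 1) :> R.
    by rewrite !natr1 -!natrM ler_nat ltnW.
  rewrite -sE => h1.
  have h2 : s * s <= 2 * (s + 1) * (k%:R + 1).
    apply: le_trans h1 _; rewrite ler_wpM2r ?addr_ge0//.
    by have := d_le_sqrt; rewrite -/s; lra.
  have s56 : 56 <= s by apply: le_trans d_le_sqrt.
  have : 0 <= (k%:R : R) by [].
  rewrite leNgt => k0; rewrite leNgt; apply/negP => ks.
  have : (s + 1) * (8 * (k%:R + 1)) < (s + 1) * (s + 8).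
    by rewrite ltr_pM2l; lra.
  have := ler_wpM2r (le_trans (ler0n R 56) s56) s56.
  lra.
set a := (L ^_ b)%:R / (M ^_ b)%:R in ratio *.
have p0 : 0 < (n%:R : R) `^ 14^-1 by rewrite powR_gt0// ltr0n.
have k0 : 0 < (k%:R : R).
  have : 0 < (n%:R : R) `^ 2^-1 by rewrite powR_gt0// ltr0n.
  by move: kR; lra.
have a0 : 0 < a by apply: lt_le_trans ratio; rewrite divr_gt0// powR_gt0// ltr0n.
rewrite powRN -[16]invrK -invfM lef_pV2 ?posrE; last 2 first.
- exact: mulr_gt0.
- by rewrite mulr_gt0// invr_gt0.
have -> : n%:R `^ 14^-1 = n%:R `^ 2^-1 * n%:R `^ (- (3 / 7)) :> R.
  rewrite -powRD; last by rewrite pnatr_eq0 -lt0n n_gt0 implybT.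
  by congr (_ `^ _); lra.
have := ler_pM (powR_ge0 _ _) _ kR ratio.
by rewrite divr_ge0 ?powR_ge0// => /(_ isT); lra.
Qed.

End Estimates.

(** * Choice of parameters and passage to the limit *)

Lemma clump_graph_process (R : realType) (n d : nat) :
  (56 <= d)%N -> (d ^ 2 <= n)%N -> ~~ odd (n * d) ->
  exists E : {set {set 'I_n}},
  [/\ regular_graph d E,
      forall U : {set 'I_n}, (2 * #|U| <= n)%N ->
        (#|U| <= 10 * edge_boundary E U)%N &
      1 - 17 * n%:R `^ (- 14^-1) <= process_prob R
        (fun s : #|E|.-tuple {set 'I_n} => (tau_1 s < tau_conn s)%N)].
Proof.
(* From [d >= 56] follows [q >= 8], so [d <= 7q + 6 < 8q]; [k] is the largest number of clumps that
   leaves half of the vertices to the core. *)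
move=> d_big dn evn; pose q := (d %/ 7)%N; pose k := (n %/ (2 * d.+1))%N.
have q7 : (7 * q <= d)%N by rewrite mulnC leq_trunc_div.
have q8 : (d < 8 * q)%N by move: d_big; rewrite /q; clear; lia.
have Kn : (2 * (k * d.+1) <= n)%N by rewrite mulnCA leq_trunc_div.
have k_big : (n < 2 * d.+1 * k.+1)%N by rewrite mulnC -ltn_divLR.
have k0 : (0 < k)%N by rewrite divn_gt0//; move: d_big dn; clear; nia.
have [E [regE expE cardc cardcut discut]] :=
  clump_graph_exists d_big dn evn q7 q8 Kn.
exists E; split=> //; have /andP[sE /forallP dE] := regE.
have M2 : (2 * #|E| = n * d)%N.
  rewrite -sum_degree// (eq_bigr (fun=> d)) => [|x _]; last exact/eqP.
  by rewrite sum_nat_const card_ord.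
have [LM bL dM] := truncated_edges R d_big dn q7 M2.
have iso := isolated_vertices_le R d_big dn q7 M2.
have clu := isolated_clumps_ge R d_big dn q7 M2 k_big.
set L := Num.truncn _ in LM bL iso clu.
(* The process is inspected at time [|E| - L], when exactly [L] edges are missing. *)
have tE : (#|E| - L <= #|E|)%N by exact: leq_subr.
have EL : (#|E| - (#|E| - L) = L)%N by rewrite subKn.
have := @process_prob_tau_lt _ E R d (2 * q) k (#|E| - L)
  (fun j => clump n d j) regE k0 tE.
rewrite EL card_ord => /(_ bL) H; apply: le_trans (H _ _ _ _).
(* 17 = 1 + 16: isolated vertices and the absence of a cut-off clump. *)
- by move: iso clu; lra.
- by move=> j; rewrite -card_gt0 cardc.
- move=> j; apply/eqP => /(congr1 (fun A : {set 'I_n} => #|A|)).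
  by rewrite cardc// cardsT card_ord; move: dn d_big; clear; nia.
- by move=> j; rewrite cardcut.
- by move=> i j ij; rewrite discut.
Qed.

Lemma process_prob_le1 (R : realType) (V : finType) (E : {set {set V}})
    (A : pred (#|E|.-tuple {set V})) : process_prob R A <= 1.
Proof.
rewrite process_prob_card ler_pdivrMr ?ltr0n ?fact_gt0// mul1r ler_nat.
by rewrite -card_Sn max_card.
Qed.


Theorem theorem1p2 (R : realType) :
  exists eps0 : R, 0 < eps0 /\
  forall (eps : R) (d : nat -> nat),
    0 < eps -> eps < eps0 ->
    (forall n : nat, (0 < n)%N -> (0 < d n)%N) ->
    (forall n : nat, (0 < n)%N -> (d n)%:R <= Num.sqrt (n%:R : R)) ->
    d @ \oo --> \oo ->
    exists G : forall n : nat, {set {set 'I_n}},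
      (\forall n \near within [set n : nat | ~~ odd (n * d n)] \oo,
        [/\ regular_graph (d n) (G n),
            forall U : {set 'I_n},
              #|U|%:R <= (n%:R / 2 : R) ->
              (#|U|%:R / 10 : R) <= (edge_boundary (G n) U)%:R
          & forall U : {set 'I_n},
              #|U|%:R <= eps * (d n)%:R / 3 ->
              (1 - eps) * (d n)%:R * #|U|%:R <= (edge_boundary (G n) U)%:R])
      /\
      process_prob R (fun s : #|G n|.-tuple {set 'I_n} =>
          (tau_1 s < tau_conn s)%N)
        @[n --> within [set n : nat | ~~ odd (n * d n)] \oo] --> (1 : R).
Proof.
exists 1; split=> // eps d eps0 _ _ d_sqrt d_oo.
(* The conditions on [n] stand as premises inside the existential, so a graph can be chosen for
   every [n]; where they fail the empty edge set is taken. *)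
have exG : forall n, exists E : {set {set 'I_n}},
    (56 <= d n)%N -> (0 < n)%N -> ~~ odd (n * d n) ->
    [/\ regular_graph (d n) E,
      forall U : {set 'I_n}, (2 * #|U| <= n)%N ->
        (#|U| <= 10 * edge_boundary E U)%N &
      1 - 17 * n%:R `^ (- 14^-1) <= process_prob R
        (fun s : #|E|.-tuple {set 'I_n} => (tau_1 s < tau_conn s)%N)].
  move=> n; have [[d56 n0 evn]|nP] := pselect [/\ (56 <= d n)%N, (0 < n)%N &
    ~~ odd (n * d n)]; last by exists finset.set0 => ? ? ?; case: nP.
  have dn : (d n ^ 2 <= n)%N.
    rewrite -(ler_nat R) natrX -[leRHS]sqr_sqrtr//.
    by apply: lerXn2r; rewrite ?nnegrE ?sqrtr_ge0// d_sqrt.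
  by have [E HE] := clump_graph_process R d56 dn evn; exists E.
pose G n := sval (cid (exG n)); have HG n := svalP (cid (exG n)).
exists G.
have near56 : \forall n \near \oo, (56 <= d n)%N.
  by apply: (d_oo [set m | (56 <= m)%N]); exists 56%N.
have near0 : \forall n \near \oo, (0 < n)%N by exists 1%N.
split.
  apply: filterS2 near56 near0 => n d56 n0 evn.
  have [reg expa _] := HG n d56 n0 evn; split=> // U.
    move=> Un; rewrite ler_pdivrMr// mulrC -natrM ler_nat expa//.
    by rewrite -(ler_nat R) natrM; move: Un; lra.
  (* The edges inside [U] cost at most [|U|^2 <= eps * d * |U| / 3]. *)
  move=> Ueps; have := edge_boundary_small U reg.
  rewrite -(ler_nat R) natrD !natrM -/(G n).
  have := ler_wpM2r (ler0n R #|U|) Ueps.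
  have : 0 <= eps * ((d n)%:R * #|U|%:R) by rewrite mulr_ge0 ?mulr_ge0// ltW.
  lra.
apply/cvgrPdist_le => e e0.
(* From [n >= (17 / e)^14] on, the error [17 n^(-1/14)] is at most [e]. *)
apply: filterS3 near56 near0 (nbhs_infty_ger ((17 / e) ^+ 14)) => n d56 n0 ne evn.
have [_ _ pr] := HG n d56 n0 evn.
rewrite ger0_norm ?subr_ge0 ?process_prob_le1//.
have : 17 * n%:R `^ (- 14^-1) <= e.
  have c0 : 0 <= 17 / e by rewrite divr_ge0// ltW.
  rewrite powRN ler_pdivrMr ?powR_gt0 ?ltr0n// -ler_pdivrMl// mulrC.
  have -> : 17 / e = ((17 / e) ^+ 14) `^ 14^-1.
    by rewrite -powR_mulrn// -powRrM divff ?powRr1.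
  by apply: ge0_ler_powR; rewrite ?nnegrE ?exprn_ge0 ?invr_ge0.
by move: pr; rewrite -/(G n); lra.
Qed.
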